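(* Let $(a_n)_{n\in\mathbb{N}}$ be a lacunary sequence of positive integers, i.e. there is $q>1$ with $\frac{a_{n+1}}{a_n}\ge q$ for all $n\in\mathbb{N}$. Let $f(x)=\sum_{d=-D}^{D}c_d e^{2\pi i d x}$ be a trigonometric polynomial with $D\in\mathbb{N}$, $c_d\in\mathbb{R}$, $c_d=c_{-d}$ for all $d$, $c_0=0$, and $\sum_{d=-D}^D c_d^2>0$. Let $U$ be uniformly distributed on $[0,1]$, $X_j=f(a_jU)$, $S_n^f=\sum_{j=1}^n X_j$, and $\sigma_n^2=\mathbb{E}(S_n^f)^2$. Let $\rho\ge 3$ be the integer such that $\gamma_3(X_1)=\cdots=\gamma_{\rho-1}(X_1)=0$ and $\gamma_\rho(X_1)\ne 0$ (for $\rho=3$ only the last requirement is imposed), and write $\gamma_\rho=\gamma_\rho(X_1)$. Assume that at least one of the following two conditions holds: (1) $\displaystyle\frac{a_{n+1}}{n^{\rho-1}a_n}\to\infty$ as $n\to\infty$; (2) $\frac{a_{n+1}}{a_n}\in\mathbb{N}$ for all $n\in\mathbb{N}$, and there exists a sequence $(x_n)_{n\in\mathbb{N}}$ of positive real numbers converging to $0$ such that $\displaystyle\sum_{k=\lceil n^{1/\rho}x_n\rceil}^{n}\frac{a_k}{a_{k+1}}=o(n^{1/\rho})$ as $n\to\infty$. Then, as $n\to\infty$, $$\exp\Bigl(-\frac{\theta^2 n^{1-2/\rho}\,\mathbb{E}X_1^2}{2}\Bigr)\,\mathbb{E}\exp\Bigl(\theta\,\frac{S_n^f}{n^{1/\rho}}\Bigr)\longrightarrow\exp\Bigl(\frac{\theta^\rho\gamma_\rho}{\rho!}\Bigr)$$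 and $$\exp\Bigl(-\frac{\theta^2\sigma_n^2}{2n^{2/\rho}}\Bigr)\,\mathbb{E}\exp\Bigl(\theta\,\frac{S_n^f}{n^{1/\rho}}\Bigr)\longrightarrow\exp\Bigl(\frac{\theta^\rho\gamma_\rho}{\rho!}\Bigr),$$ both locally uniformly in $\theta\in\mathbb{C}$.
   Context: For $m\in\mathbb{N}$, the $m$-th cumulant of a random variable $Z$ with $\mathbb{E}e^{tZ}<\infty$ for $t$ in a neighbourhood of $0$ is $\gamma_m(Z)=\frac{\partial^m}{\partial t^m}\log\mathbb{E}(e^{tZ})\big|_{t=0}$. *)

(* Defs.v *)
From HB Require Import structures.
From mathcomp Require Import all_boot all_order all_algebra.
From mathcomp Require Import complex.
From mathcomp Require Import all_classical all_reals all_analysis.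

Set Implicit Arguments.
Unset Strict Implicit.
Unset Printing Implicit Defensive.

Import Order.TTheory GRing.Theory Num.Theory numFieldNormedType.Exports.

Local Open Scope classical_set_scope.
Local Open Scope ring_scope.
Local Open Scope complex_scope.

Definition cexp (R : realType) (z : R[i]) : R[i] :=
  (expR (complex.Re z) * cos (complex.Im z))
    +i* (expR (complex.Re z) * sin (complex.Im z)).

Definition cexpectation (d : measure_display) (T : measurableType d)
    (R : realType) (P : probability T R) (Z : T -> R[i]) : R[i] :=
  fine ('E_P[fun w => complex.Re (Z w)])%E
    +i* fine ('E_P[fun w => complex.Im (Z w)])%E.

Definition cumulant (d : measure_display) (T : measurableType d)
    (R : realType) (P : probability T R) (Z : T -> R) (m : nat) : R :=
  derive1n m (fun t : R => ln (fine (mmt_gen_fun P Z t))) 0.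

(* The library's measures are total functions whose values on non-measurable
   sets are arbitrary, so the two laws are compared on Borel sets only. *)
Definition uniform01 (d : measure_display) (T : measurableType d)
    (R : realType) (P : probability T R) (U : {RV P >-> R}) : Prop :=
  forall A : set R, measurable A ->
    distribution P U A = uniform_prob (@ltr01 R) A.

(* The frequency d = k - D runs over -D, ..., D. *)
Definition trig_poly (R : realType) (D : nat) (c : int -> R) (x : R) : R[i] :=
  \sum_(k < (2 * D).+1)
    let d : int := k%:Z - D%:Z in
    (c d)%:C * cexp (0 +i* (2 * pi * d%:~R * x)).

Definition dilate (R : realType) (T : Type) (f : R -> R) (a : nat -> nat)
    (U : T -> R) (j : nat) : T -> R :=
  fun w => f ((a j)%:R * U w).

Definition dilate_sum (R : realType) (T : Type) (f : R -> R) (a : nat -> nat)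
    (U : T -> R) (n : nat) : T -> R :=
  fun w => \sum_(1 <= j < n.+1) dilate f a U j w.

(* The library puts the topology of the modulus |z| on the regular module
   R[i]^o, which is convertible to R[i]. *)
Definition locally_uniform_cvg (R : realType) (F : nat -> R[i] -> R[i])
    (G : R[i] -> R[i]) : Prop :=
  forall z : R[i]^o, exists2 V : set R[i]^o, nbhs z V &
    {uniform V, (F : nat -> R[i]^o -> R[i]^o) @ \oo
                  --> (G : R[i]^o -> R[i]^o)}.

(* Main.v *)
Require Import Defs.
From HB Require Import structures.
From mathcomp Require Import all_boot all_order all_algebra.
From mathcomp Require Import complex.
From mathcomp Require Import all_classical all_reals all_analysis.
From mathcomp Require Import measurable_realfun.
From mathcomp Require Import zify ring lra.

Set Implicit Arguments.
Unset Strict Implicit.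
Unset Printing Implicit Defensive.

Import Order.TTheory GRing.Theory Num.Theory numFieldNormedType.Exports.

Local Open Scope classical_set_scope.
Local Open Scope ring_scope.
Local Open Scope complex_scope.

(** Put l = theta / n^(1/rho), phi(l) = E exp(l X_1) and g = exp(l f) / phi(l), a
    periodic function of mean 1 with sup |g - 1| and Lipschitz constant O(|l|).
    The quotient of the two moment generating functions is
    E exp(l S_n) / phi(l)^n = E prod_j g(a_j U), and it tends to 1:

    - if a_k divides a_(k+1), averaging prod_(j<k) g(a_j x) over the shifts by
      multiples of 1/a_k gives a 1/a_k-periodic function H_k.  Since H_(k+1) is
      the average of H_k g(a_k .), the relative oscillation of H_k stays
      O(|l| a_(k-1)/a_k), and each step multiplies the mean by
      1 + O(|l|^2 a_(k-1)/a_k);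

    - if the gaps are large, the k-th step changes the mean by a multiple of
      E exp(l S_(k-1)) (g(a_k U) - 1).  The p-th Taylor term of the exponential is
      a trigonometric polynomial of degree at most p D a_(k-1), orthogonal to
      g(a_k .) - 1 as long as this is below a_k; only the tail p >= k remains,
      and it is geometrically small in k.

    It remains to expand phi(l)^n.  On the real line log phi(t) is
    E X_1^2 t^2/2 + gamma_rho t^rho/rho! + O(t^(rho+1)), which determines the
    Taylor coefficients of phi up to order rho, hence the same expansion for
    complex l; and n |l|^(rho+1) tends to 0.  Finally sigma_n^2 - n E X_1^2 is
    bounded by a multiple of sum a_(k-1)/a_k, which is o(n^(2/rho)). *)

(** For real theta, E exp(l S_n) grows like an exponential of n^(1-2/rho), so additive errors are
    useless and every estimate has to be relative. Dividing each factor by phi(l) achieves this, but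
    g is complex valued: it is not a probability density, and positivity cannot be used to compare
    means.

    In the divisible chain a bound by sup norms would grow like (1 + C |l|)^n, where n |l| is
    unbounded. Hence the Lipschitz constant of H_k is carried as a multiple of the modulus of its
    own mean, and the smallness of |l| keeps this invariant stable. With large gaps the crude bound
    |phi(l)|^(-k) <= 2^k is affordable, because the Taylor tail decays at a faster geometric rate.

    The constant 1/160 makes 16 |l| M at most 1/10, where M bounds both |f| and its Lipschitz
    constant and 16 |l| M is the bound obtained for g - 1.

    Cumulants are derivatives of a real logarithm. Passing through Taylor polynomials means that no
    complex logarithm, and no choice of branch, ever appears. *)

Local Notation normc := ComplexField.Normc.normc.
Local Notation Re := complex.Re.
Local Notation Im := complex.Im.

(** * Complex modulus, real derivatives and the complex exponential *)

Section ComplexModulus.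
Variable R : realType.
Implicit Types (z w : R[i]).

Lemma normr_normc z : `|z| = (normc z)%:C.
Proof. by case: z => x y; rewrite normc_def. Qed.

Lemma normc_ge0 z : 0 <= normc z.
Proof. by case: z => x y; exact: sqrtr_ge0. Qed.

Lemma normc_real (x : R) : normc x%:C = `|x|.
Proof. by rewrite /= expr0n addr0 sqrtr_sqr. Qed.

Lemma normc_sqr z : normc z ^+ 2 = Re z ^+ 2 + Im z ^+ 2.
Proof. by case: z => x y /=; rewrite sqr_sqrtr// addr_ge0 ?sqr_ge0. Qed.

Lemma normcX z n : normc (z ^+ n) = normc z ^+ n.
Proof.
by elim: n => [|n ih]; rewrite ?ComplexField.Normc.normc1// !exprS
  ComplexField.Normc.normcM ih.
Qed.

Lemma Re_le_normc z : `|Re z| <= normc z.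
Proof.
rewrite -(@ler_pXn2r _ 2)// ?nnegrE ?normc_ge0// normc_sqr real_normK ?num_real//.
by rewrite lerDl sqr_ge0.
Qed.

Lemma Im_le_normc z : `|Im z| <= normc z.
Proof.
rewrite -(@ler_pXn2r _ 2)// ?nnegrE ?normc_ge0// normc_sqr real_normK ?num_real//.
by rewrite lerDr sqr_ge0.
Qed.

Lemma normc_le_ReIm z : normc z <= `|Re z| + `|Im z|.
Proof.
rewrite -(@ler_pXn2r _ 2)// ?nnegrE ?normc_ge0// ?addr_ge0// normc_sqr.
rewrite -[Re z ^+ 2]real_normK ?num_real// -[Im z ^+ 2]real_normK ?num_real//.
by rewrite sqrrD lerD2r lerDl mulrn_wge0// mulr_ge0.
Qed.

Lemma normcD z w : normc (z + w) <= normc z + normc w.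
Proof. exact: le_normcD. Qed.

Lemma normcB z w : normc (z - w) = normc (w - z).
Proof. by rewrite -normcN opprB. Qed.

Lemma normc_distD z w v : normc (z - v) <= normc (z - w) + normc (w - v).
Proof. by rewrite -[z - v](subrKA w) normcD. Qed.

Lemma normc_subr z w : normc z - normc w <= normc (z - w).
Proof. by rewrite lerBlDr -{1}[z](subrK w) normcD. Qed.

Lemma normc_sum I (r : seq I) (F : I -> R[i]) :
  normc (\sum_(i <- r) F i) <= \sum_(i <- r) normc (F i).
Proof.
elim/big_rec2 : _ => [|i x y _ h]; first by rewrite ComplexField.Normc.normc0.
by rewrite (le_trans (normcD _ _))// lerD2l.
Qed.

Lemma Re_sum I (r : seq I) (F : I -> R[i]) :
  Re (\sum_(i <- r) F i) = \sum_(i <- r) Re (F i).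
Proof.
by elim/big_rec2 : _ => [//|i x y _ <-]; case: (F i) y => ? ? [].
Qed.

Lemma Im_sum I (r : seq I) (F : I -> R[i]) :
  Im (\sum_(i <- r) F i) = \sum_(i <- r) Im (F i).
Proof.
by elim/big_rec2 : _ => [//|i x y _ <-]; case: (F i) y => ? ? [].
Qed.

Lemma Re_scale (x : R) z : Re (x%:C * z) = x * Re z.
Proof. by case: z => a b /=; rewrite mul0r subr0. Qed.

Lemma Im_scale (x : R) z : Im (x%:C * z) = x * Im z.
Proof. by case: z => a b /=; rewrite mul0r addr0. Qed.

Lemma Re_add z w : Re (z + w) = Re z + Re w.
Proof. by case: z; case: w. Qed.

Lemma Im_add z w : Im (z + w) = Im z + Im w.
Proof. by case: z; case: w. Qed.

Lemma Re_mul z w : Re (z * w) = Re z * Re w - Im z * Im w.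
Proof. by case: z; case: w. Qed.

Lemma Im_mul z w : Im (z * w) = Re z * Im w + Im z * Re w.
Proof. by case: z; case: w. Qed.

Lemma complex_eq z w : Re z = Re w -> Im z = Im w -> z = w.
Proof. by case: z w => a b [c d] /= -> ->. Qed.

Lemma Re_divn z n : Re (z / n%:R) = Re z / n%:R.
Proof.
by rewrite -[n%:R in LHS](rmorph_nat (real_complex R)) -fmorphV mulrC Re_scale mulrC.
Qed.

Lemma Im_divn z n : Im (z / n%:R) = Im z / n%:R.
Proof.
by rewrite -[n%:R in LHS](rmorph_nat (real_complex R)) -fmorphV mulrC Im_scale mulrC.
Qed.

End ComplexModulus.

Section RealDerivatives.
Variable R : realType.
Implicit Types (f g : R -> R) (x a b : R).

Lemma is_derive_addf f g x a b : is_derive x (1 : R) f a -> is_derive x (1 : R) g b ->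
  is_derive x (1 : R) (fun t => f t + g t) (a + b).
Proof. by move=> fa gb; exact: is_deriveD. Qed.

Lemma is_derive_subf f g x a b : is_derive x (1 : R) f a -> is_derive x (1 : R) g b ->
  is_derive x (1 : R) (fun t => f t - g t) (a - b).
Proof. by move=> fa gb; exact: is_deriveB. Qed.

Lemma is_derive_mulf f g x a b : is_derive x (1 : R) f a -> is_derive x (1 : R) g b ->
  is_derive x (1 : R) (fun t => f t * g t) (a * g x + f x * b).
Proof.
by move=> fa gb; apply: (is_derive_eq (is_deriveM fa gb)); rewrite addrC mulrC.
Qed.

Lemma is_derive_scalef f x a (k : R) : is_derive x (1 : R) f a ->
  is_derive x (1 : R) (fun t => k * f t) (k * a).
Proof. by move=> fa; exact: (is_deriveZ k fa). Qed.

Lemma is_derive_compf f g x a b : is_derive (g x) (1 : R) f a ->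
  is_derive x (1 : R) g b -> is_derive x (1 : R) (fun t => f (g t)) (a * b).
Proof. by move=> fa gb; exact: (is_derive1_comp fa gb). Qed.

Lemma is_derive_linear (k x : R) : is_derive x (1 : R) (fun t => t * k) k.
Proof.
have := is_derive_scalef k (is_derive_id x (1 : R)); rewrite mulr1.
by under eq_fun do rewrite mulrC.
Qed.

Lemma is_derive_pow n x : is_derive x (1 : R) (fun t => t ^+ n.+1) (n.+1%:R * x ^+ n).
Proof.
have := is_deriveX n.+1 (is_derive_id x (1 : R)); rewrite /GRing.scale /= mulr1.
by congr is_derive; apply/funext => t; rewrite exprfctE.
Qed.

Lemma is_derive_continuous f (df : R -> R) :
  (forall x, is_derive x (1 : R) f (df x)) -> continuous f.
Proof.
move=> fdf x; apply: differentiable_continuous; apply/derivable1_diffP.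
by have [] := fdf x.
Qed.

Lemma is_derive_nondecreasing f (df : R -> R) (a b : R) : a <= b ->
  (forall x, a <= x <= b -> is_derive x (1 : R) f (df x)) ->
  (forall x, a <= x <= b -> 0 <= df x) -> f a <= f b.
Proof.
move=> ab fdf df0; have [x||c] := @MVT_segment _ f df a b ab.
- by rewrite in_itv /= => /andP[ax xb]; apply: fdf; rewrite !ltW.
- apply: derivable_within_continuous => x; rewrite in_itv /= => /fdf dfx.
  exact: ex_derive.
rewrite in_itv /= => cab E; rewrite -subr_ge0 E mulr_ge0 ?subr_ge0//.
exact: df0.
Qed.

End RealDerivatives.

Section ComplexExponential.
Variable R : realType.
Implicit Types (z w : R[i]).

Lemma cexpD z w : cexp (z + w) = cexp z * cexp w.
Proof.
case: z w => x y [x' y']; apply: complex_eq => /=; rewrite expRD ?cosD ?sinD; ring.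
Qed.

Lemma cexp0 : cexp (0 : R[i]) = 1.
Proof. by rewrite /cexp /= expR0 cos0 sin0 mulr0 mul1r. Qed.

Lemma cexpN z : cexp (- z) * cexp z = 1.
Proof. by rewrite -cexpD addNr cexp0. Qed.

Lemma cexp_sum I (r : seq I) (F : I -> R[i]) :
  cexp (\sum_(i <- r) F i) = \prod_(i <- r) cexp (F i).
Proof.
by elim/big_rec2 : _ => [|i x y _ h]; rewrite ?cexp0// cexpD h.
Qed.

Lemma cexpMn z n : cexp (n%:R * z) = cexp z ^+ n.
Proof.
elim: n => [|n ih]; first by rewrite mul0r cexp0.
by rewrite exprS -ih -cexpD -natr1 mulrDl mul1r addrC.
Qed.

Lemma normc_cexp z : normc (cexp z) = expR (Re z).
Proof.
rewrite /cexp /= !exprMn -mulrDr cos2Dsin2 mulr1 sqrtr_sqr ger0_norm//.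
Qed.

Lemma normc_cexp_le z : normc (cexp z) <= expR (normc z).
Proof.
by rewrite normc_cexp ler_expR (le_trans _ (Re_le_normc z))// ler_norm.
Qed.

Lemma cexp_real (x : R) : cexp x%:C = (expR x)%:C.
Proof. by rewrite /cexp /= cos0 sin0 mulr1 mulr0. Qed.

(** For each sign s, the function [C / N.+1%:R * x ^+ N.+1 - s * u x] vanishes at 0 and has
    nonnegative derivative on [0, 1]; monotonicity replaces integration of the bound. *)
Lemma derive_pow_bound (u v : R -> R) (C : R) (N : nat) :
  (forall t, is_derive t (1 : R) u (v t)) -> u 0 = 0 ->
  (forall t, 0 <= t <= 1 -> `|v t| <= C * t ^+ N) ->
  forall t, 0 <= t <= 1 -> `|u t| <= C * t ^+ N.+1 / N.+1%:R.
Proof.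
move=> du u0 vC t /andP[t0 t1].
have key (s : R) : `|s| = 1 -> s * u t <= C * t ^+ N.+1 / N.+1%:R.
  move=> s1.
  pose w x := C / N.+1%:R * x ^+ N.+1 - s * u x.
  have dw x : is_derive x (1 : R) w (C * x ^+ N - s * v x).
    have := is_derive_subf (is_derive_scalef (C / N.+1%:R) (is_derive_pow N x))
      (is_derive_scalef s (du x)).
    by rewrite mulrA divfK// pnatr_eq0.
  have : w 0 <= w t.
    apply: (is_derive_nondecreasing t0 (fun x _ => dw x)) => x /andP[x0 xt].
    rewrite subr_ge0 (le_trans (ler_norm _))// normrM s1 mul1r vC//.
    by rewrite x0 (le_trans xt).
  by rewrite /w u0 expr0n /= !mulr0 !subr0 subr_ge0 => /le_trans; apply; rewrite mulrAC.
rewrite ler_norml; apply/andP; split.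
  by rewrite lerNl -mulN1r key// normrN normr1.
by rewrite -[u t]mul1r key// normr1.
Qed.

(* Integrating the real and imaginary parts separately costs a factor 2 at each
   step, whence 2 ^ N. *)
Lemma cexp_taylor z N :
  normc (cexp z - \sum_(p < N) z ^+ p / p`!%:R)
    <= (2 * normc z) ^+ N / N`!%:R * expR (normc z).
Proof.
pose P n : R[i] -> {poly R} := fun w => \poly_(p < n) (Re (w ^+ p) / p`!%:R).
pose Q n : R[i] -> {poly R} := fun w => \poly_(p < n) (Im (w ^+ p) / p`!%:R).
pose h n (t : R) : R[i] := cexp (t%:C * z) - ((P n z).[t] +i* (Q n z).[t]).
have hE n (t : R) : h n t = cexp (t%:C * z) - \sum_(p < n) (t%:C * z) ^+ p / p`!%:R.
  congr (_ - _); apply: complex_eq; rewrite ?Re_sum ?Im_sum /= horner_poly;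
    apply: eq_bigr => p _; rewrite exprMn -(rmorphXn (real_complex R)) /=.
    by rewrite Re_divn Re_scale; ring.
  by rewrite Im_divn Im_scale; ring.
(* Induction on the order along the segment from 0 to z: [h n.+1] vanishes at 0 and its derivative
   in t is [z * h n]. *)
suff key n (t : R) : 0 <= t <= 1 -> normc (h n t) <= (2 * normc z) ^+ n / n`!%:R * expR (normc z) * t ^+ n.
  have := key N 1; rewrite hE expr1n mulr1 mul1r; apply; by rewrite ler01 lexx.
elim: n t => [|n ih] t t01.
  rewrite hE big_ord0 subr0 !expr0 mulr1 divr1 mul1r.
  rewrite (le_trans (normc_cexp_le _))// ler_expR ComplexField.Normc.normcM normc_real.
  by case/andP: t01 => t0 t1; rewrite ger0_norm// ler_piMl// normc_ge0.
have dP : (P n.+1 z)^`() = Re z *: P n z - Im z *: Q n z.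
  apply/polyP => p; rewrite coef_deriv coefB !coefZ !coef_poly ltnS.
  case: ltnP => pn; last by rewrite mul0rn !mulr0 subr0.
  rewrite exprS Re_mul factS natrM -mulr_natl invfM; field.
  by rewrite nat1r !pnatr_eq0 -lt0n fact_gt0.
have dQ : (Q n.+1 z)^`() = Re z *: Q n z + Im z *: P n z.
  apply/polyP => p; rewrite coef_deriv coefD !coefZ !coef_poly ltnS.
  case: ltnP => pn; last by rewrite mul0rn !mulr0 addr0.
  rewrite exprS Im_mul factS natrM -mulr_natl invfM; field.
  by rewrite nat1r !pnatr_eq0 -lt0n fact_gt0.
have h0 : h n.+1 0 = 0.
  by rewrite hE mul0r cexp0 big_ord_recl expr0 divr1 big1 ?addr0 ?subrr//
    => i _; rewrite expr0n /= mul0r.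
have dRe (s : R) : is_derive s (1 : R) (fun t => Re (h n.+1 t)) (Re (z * h n s)).
  have -> : (fun t => Re (h n.+1 t)) =
      (fun t => expR (t * Re z) * cos (t * Im z) - (P n.+1 z).[t]).
    by apply/funext => x; rewrite /h Re_add /cexp /= Re_scale Im_scale.
  have := is_derive_subf (is_derive_mulf
    (is_derive_compf (is_derive_expR _) (is_derive_linear (Re z) s))
    (is_derive_compf (is_derive_cos _) (is_derive_linear (Im z) s)))
    (is_derive_poly (P n.+1 z) s).
  move/is_derive_eq; apply; rewrite dP !hornerE /GRing.scale /= Re_mul /h /cexp /= Re_scale Im_scale.
  ring.
have dIm (s : R) : is_derive s (1 : R) (fun t => Im (h n.+1 t)) (Im (z * h n s)).
  have -> : (fun t => Im (h n.+1 t)) =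
      (fun t => expR (t * Re z) * sin (t * Im z) - (Q n.+1 z).[t]).
    by apply/funext => x; rewrite /h Im_add /cexp /= Re_scale Im_scale.
  have := is_derive_subf (is_derive_mulf
    (is_derive_compf (is_derive_expR _) (is_derive_linear (Re z) s))
    (is_derive_compf (is_derive_sin _) (is_derive_linear (Im z) s)))
    (is_derive_poly (Q n.+1 z) s).
  move/is_derive_eq; apply; rewrite dQ !hornerE /GRing.scale /= Im_mul /h /cexp /= Re_scale Im_scale.
  ring.
pose C := normc z * ((2 * normc z) ^+ n / n`!%:R * expR (normc z)).
have bnd s : 0 <= s <= 1 -> normc (z * h n s) <= C * s ^+ n.
  move=> s01; rewrite ComplexField.Normc.normcM /C -[leRHS]mulrA ler_wpM2l ?normc_ge0// ih//.
have bRe := derive_pow_bound dRe (congr1 (@complex.Re R) h0) (fun s s01 => le_trans (Re_le_normc _) (bnd s s01)) t01.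
have bIm := derive_pow_bound dIm (congr1 (@complex.Im R) h0) (fun s s01 => le_trans (Im_le_normc _) (bnd s s01)) t01.
rewrite (le_trans (normc_le_ReIm _))// (le_trans (lerD bRe bIm))// /C.
rewrite le_eqVlt; apply/orP; left; apply/eqP.
rewrite factS natrM invfM !exprS; field.
by rewrite nat1r !pnatr_eq0 -lt0n fact_gt0.
Qed.

Lemma cexp_sub1 z : normc (cexp z - 1) <= 2 * normc z * expR (normc z).
Proof.
have := cexp_taylor z 1.
by rewrite big_ord_recl big_ord0 expr0 divr1 addr0 expr1 divr1.
Qed.

End ComplexExponential.

(** * Means over a period *)

Section Mean.
Variable R : realType.
Implicit Types (h k F : R -> R).
Local Notation mu := (@lebesgue_measure R).

Definition mean h : R := \int[mu]_(x in `[0, 1]) h x.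

Lemma continuous_integrable_itv h (a b : R) : continuous h ->
  mu.-integrable `[a, b] (EFin \o h).
Proof.
move=> ch; apply: continuous_compact_integrable; first exact: segment_compact.
exact: continuous_subspaceT.
Qed.

Lemma mean_cst (c : R) : mean (fun=> c) = c.
Proof.
by rewrite /mean Rintegral_cst//= lebesgue_measure_itv/= lte_fin ltr01 oppr0 adde0 mulr1.
Qed.

Lemma meanD h k : continuous h -> continuous k ->
  mean (fun x => h x + k x) = mean h + mean k.
Proof. by move=> ch ck; rewrite /mean RintegralD//; exact: continuous_integrable_itv. Qed.

Lemma meanZ (c : R) h : continuous h -> mean (fun x => c * h x) = c * mean h.
Proof. by move=> ch; rewrite /mean RintegralZl//; exact: continuous_integrable_itv. Qed.

Lemma le_mean h k : continuous h -> continuous k -> (forall x, h x <= k x) ->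
  mean h <= mean k.
Proof.
move=> ch ck hk; rewrite /mean; apply: le_Rintegral => //;
  exact: continuous_integrable_itv.
Qed.

(** The integral from [- A] is a primitive inside a bounded window; each use picks A large enough
    for the points it visits. *)
Lemma exists_primitive h (A : R) : continuous h ->
  exists F : R -> R, forall x : R, - A < x < A -> is_derive x (1 : R) F (h x).
Proof.
move=> ch; exists (fun x => \int[mu]_(t in `[- A, x]) h t) => x /andP[Ax xA].
have [dF dFE] := @continuous_FTC1_closed R h (- A) x A xA
  (continuous_integrable_itv (- A) A ch) Ax (ch x).
by apply: (DeriveDef dF); rewrite -derive1E dFE.
Qed.

Lemma mean_primitive h F : continuous h ->
  (forall x : R, 0 <= x <= 1 -> is_derive x (1 : R) F (h x)) -> mean h = F 1 - F 0.
Proof.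
move=> ch dF.
have cF (x : R) : 0 <= x <= 1 -> {for x, continuous F}.
  move=> /dF dFx; apply: differentiable_continuous; apply/derivable1_diffP.
  exact: ex_derive.
rewrite /mean /Rintegral (@continuous_FTC2 R h F 0 1)//.
- exact: continuous_subspaceT.
- split.
  + move=> x; rewrite in_itv/= => /andP[x0 x1].
    by have [] := dF x; rewrite ?(ltW x0) ?(ltW x1).
  + by apply: cvg_at_right_filter; apply: cF; rewrite lexx ler01.
  + by apply: cvg_at_left_filter; apply: cF; rewrite lexx ler01.
- move=> x; rewrite in_itv/= => /andP[x0 x1].
  by have [] := dF x; rewrite ?(ltW x0) ?(ltW x1)// derive1E.
Qed.

Definition periodic1 T (h : R -> T) := forall x, h (x + 1) = h x.

Lemma periodic1_nat T (h : R -> T) n x : periodic1 h -> h (x + n%:R) = h x.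
Proof.
move=> ph; elim: n => [|n ih]; first by rewrite addr0.
by rewrite -natr1 addrA ph.
Qed.

(** The increment of F over one period has derivative [h (x + 1) - h x], which is 0. *)
Lemma primitive_periodic h F (A : R) : periodic1 h ->
  (forall x : R, - A < x < A -> is_derive x (1 : R) F (h x)) ->
  forall x : R, 0 <= x -> x + 1 < A -> F (x + 1) - F x = F 1 - F 0.
Proof.
move=> ph dF x x0 xA.
have dG (y : R) : 0 <= y <= x -> is_derive y (1 : R) (fun t => F (t + 1) - F t) 0.
  move=> /andP[y0 yx].
  have d1 : is_derive (y + 1) (1 : R) F (h (y + 1)) by apply: dF; lra.
  have d2 : is_derive y (1 : R) F (h y) by apply: dF; lra.
  have := is_derive_subf (@is_derive_compf _ F (fun t => t + 1) y _ _ d1 (is_derive_shift y 1 1)) d2.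
  by rewrite mulr1 ph subrr.
apply/eqP; rewrite eq_le; apply/andP; split.
  have dN (y : R) : 0 <= y <= x -> is_derive y (1 : R) (fun t => -1 * (F (t + 1) - F t)) 0.
    by move=> /dG /(is_derive_scalef (-1)); rewrite mulr0.
  have /= := is_derive_nondecreasing x0 dN (fun _ _ => lexx _).
  by rewrite add0r !mulN1r lerN2.
have /= := is_derive_nondecreasing x0 dG (fun _ _ => lexx _).
by rewrite add0r.
Qed.

Lemma mean_shift h (s : R) : continuous h -> periodic1 h -> 0 <= s <= 1 ->
  mean (fun x => h (x + s)) = mean h.
Proof.
move=> ch ph /andP[s0 s1]; have [F dF] := exists_primitive 3 ch.
have -> : mean h = F 1 - F 0.
  by apply: mean_primitive => // x /andP[? ?]; apply: dF; lra.
rewrite -(@primitive_periodic h F 3 ph dF s s0); last by lra.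
have -> : mean (fun x => h (x + s)) = F (1 + s) - F (0 + s).
  apply: (@mean_primitive _ (fun x => F (x + s))).
    by move=> x; apply: continuous_comp; [apply: cvgD; [exact: cvg_id|exact: cvg_cst]|exact: ch].
  move=> x /andP[? ?]; rewrite -[h (x + s)]mulr1.
  apply: (@is_derive_compf _ F (fun t => t + s) x _ _ _ (is_derive_shift x 1 s)).
  by apply: dF; lra.
by rewrite add0r (addrC 1).
Qed.

(** With a primitive F of h, the left side is [(F n%:R - F 0) / n%:R], and the increment of F over n
    periods is n times its increment over one. *)
Lemma mean_dilate h n : continuous h -> periodic1 h -> (0 < n)%N ->
  mean (fun x => h (n%:R * x)) = mean h.
Proof.
move=> ch ph n0; have [F dF] := exists_primitive n.+2%:R ch.
have n0' : 0 < n%:R :> R by rewrite ltr0n.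
have nA : n.+2%:R = n%:R + 2 :> R by rewrite -addn2 natrD.
have -> : mean h = F 1 - F 0.
  by apply: mean_primitive => // x /andP[? ?]; apply: dF; rewrite nA; lra.
have -> : mean (fun x => h (n%:R * x)) = n%:R^-1 * F (n%:R * 1) - n%:R^-1 * F (n%:R * 0).
  apply: (@mean_primitive _ (fun x => n%:R^-1 * F (n%:R * x))).
    move=> x; apply: continuous_comp; last exact: ch.
    by apply: continuousM => //; exact: cst_continuous.
  move=> x /andP[x0 x1].
  have d : is_derive (n%:R * x) (1 : R) F (h (n%:R * x)).
    apply: dF; rewrite nA; apply/andP; split.
      by rewrite (lt_le_trans _ (mulr_ge0 (ltW n0') x0))//; lra.
    have : n%:R * x <= n%:R * 1 by rewrite ler_wpM2l// ltW.
    lra.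
  have := is_derive_scalef (n%:R^-1)
    (is_derive_compf d (is_derive_scalef n%:R (is_derive_id x (1 : R)))).
  by rewrite mulr1 mulrC mulfK// gt_eqF.
rewrite mulr1 mulr0 -mulrBr.
suff H (k : nat) : (k <= n)%N -> F k%:R - F 0 = k%:R * (F 1 - F 0).
  by rewrite H// mulKf// gt_eqF.
elim: k => [|k ih] kn; first by rewrite mul0r subrr.
rewrite -natr1 mulrDl mul1r -(ih (ltnW kn)).
rewrite -(@primitive_periodic h F n.+2%:R ph dF k%:R)//; first by ring.
by rewrite natr1 ltr_nat; apply: ltnW.
Qed.

End Mean.

Section ComplexMean.
Variable R : realType.
Implicit Types (F G : R -> R[i]) (h : R -> R).

(** Stated by components, like [cmean] below, so that integration stays on real functions of a real
    variable. *)
Definition ccontinuous F :=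
  continuous (fun x => Re (F x)) /\ continuous (fun x => Im (F x)).

Definition cmean F : R[i] :=
  mean (fun x => Re (F x)) +i* mean (fun x => Im (F x)).

Lemma ccontinuous_cst (c : R[i]) : ccontinuous (fun=> c).
Proof. by split=> x; exact: cst_continuous. Qed.

Lemma ccontinuous_real h : continuous h -> ccontinuous (fun x => (h x)%:C).
Proof. by split=> //= x; exact: cst_continuous. Qed.

Lemma ccontinuousD F G : ccontinuous F -> ccontinuous G ->
  ccontinuous (fun x => F x + G x).
Proof.
move=> [F1 F2] [G1 G2]; split=> x.
  by under eq_fun do rewrite Re_add; apply: continuousD; [exact: F1|exact: G1].
by under eq_fun do rewrite Im_add; apply: continuousD; [exact: F2|exact: G2].
Qed.

Lemma ccontinuousM F G : ccontinuous F -> ccontinuous G ->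
  ccontinuous (fun x => F x * G x).
Proof.
move=> [F1 F2] [G1 G2]; split=> x.
  under eq_fun do rewrite Re_mul; apply: cvgB; apply: cvgM;
    by [exact: F1|exact: G1|exact: F2|exact: G2].
under eq_fun do rewrite Im_mul; apply: cvgD; apply: cvgM;
    by [exact: F1|exact: G1|exact: F2|exact: G2].
Qed.

Lemma ccontinuousB F G : ccontinuous F -> ccontinuous G ->
  ccontinuous (fun x => F x - G x).
Proof.
move=> cF cG; under eq_fun do rewrite -mulN1r.
exact/ccontinuousD/ccontinuousM/cG/ccontinuous_cst.
Qed.

Lemma ccontinuousX F n : ccontinuous F -> ccontinuous (fun x => F x ^+ n).
Proof.
move=> cF; elim: n => [|n ih]; first exact: ccontinuous_cst.
by under eq_fun do rewrite exprS; exact: ccontinuousM.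
Qed.

Lemma ccontinuous_sum (I : Type) (r : seq I) (F : I -> R -> R[i]) :
  (forall i, ccontinuous (F i)) -> ccontinuous (fun x => \sum_(i <- r) F i x).
Proof.
move=> cF; elim: r => [|i r ih].
  by under eq_fun do rewrite big_nil; exact: ccontinuous_cst.
by under eq_fun do rewrite big_cons; exact: ccontinuousD.
Qed.

Lemma ccontinuous_comp F (h : R -> R) : ccontinuous F -> continuous h ->
  ccontinuous (fun x => F (h x)).
Proof.
move=> [F1 F2] ch; split=> x.
  exact: (@continuous_comp _ _ _ h (fun y => Re (F y)) x (ch x) (F1 (h x))).
exact: (@continuous_comp _ _ _ h (fun y => Im (F y)) x (ch x) (F2 (h x))).
Qed.

Lemma ccontinuous_cexp F : ccontinuous F -> ccontinuous (fun x => cexp (F x)).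
Proof.
move=> [F1 F2]; split=> x; rewrite /cexp /=; apply: cvgM.
- exact: (continuous_comp (F1 x) (@continuous_expR R _)).
- exact: (continuous_comp (F2 x) (@continuous_cos R _)).
- exact: (continuous_comp (F1 x) (@continuous_expR R _)).
- exact: (continuous_comp (F2 x) (@continuous_sin R _)).
Qed.

Lemma cmean_cst (c : R[i]) : cmean (fun=> c) = c.
Proof. by rewrite /cmean !mean_cst; case: c. Qed.

Lemma cmean_real h : cmean (fun x => (h x)%:C) = (mean h)%:C.
Proof. by rewrite /cmean /= mean_cst. Qed.

Lemma cmeanD F G : ccontinuous F -> ccontinuous G ->
  cmean (fun x => F x + G x) = cmean F + cmean G.
Proof.
move=> [F1 F2] [G1 G2]; apply: complex_eq => /=.
  by under [X in mean X]eq_fun do rewrite Re_add; rewrite meanD.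
by under [X in mean X]eq_fun do rewrite Im_add; rewrite meanD.
Qed.

Lemma cmeanZ (c : R[i]) F : ccontinuous F -> cmean (fun x => c * F x) = c * cmean F.
Proof.
move=> [F1 F2].
have cZ (a : R) h : continuous h -> continuous (fun x => a * h x).
  by move=> ch x; apply: continuousM; [exact: cst_continuous|exact: ch].
apply: complex_eq; rewrite ?Re_mul ?Im_mul /=.
  under [X in mean X]eq_fun do rewrite Re_mul -mulNr.
  by rewrite meanD ?meanZ ?mulNr//; exact: cZ.
under [X in mean X]eq_fun do rewrite Im_mul.
by rewrite meanD ?meanZ//; exact: cZ.
Qed.

Lemma cmeanB F G : ccontinuous F -> ccontinuous G ->
  cmean (fun x => F x - G x) = cmean F - cmean G.
Proof.
move=> cF cG; under [X in cmean X]eq_fun do rewrite -mulN1r.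
rewrite cmeanD ?cmeanZ ?mulN1r//; exact/ccontinuousM/cG/ccontinuous_cst.
Qed.

Lemma cmean_sum (I : Type) (r : seq I) (F : I -> R -> R[i]) :
  (forall i, ccontinuous (F i)) ->
  cmean (fun x => \sum_(i <- r) F i x) = \sum_(i <- r) cmean (F i).
Proof.
move=> cF; elim: r => [|i r ih].
  by under [X in cmean X]eq_fun do rewrite big_nil; rewrite cmean_cst big_nil.
under [X in cmean X]eq_fun do rewrite big_cons.
by rewrite cmeanD// ?ih ?big_cons//; exact: ccontinuous_sum.
Qed.

Lemma normc_cmean_le F (B : R) : ccontinuous F -> (forall x, normc (F x) <= B) ->
  normc (cmean F) <= B.
Proof.
move=> cF FB; have B0 : 0 <= B := le_trans (normc_ge0 (F 0)) (FB 0).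
have [z0|z0] := eqVneq (normc (cmean F)) 0; first by rewrite z0.
have zp : 0 < normc (cmean F) by rewrite lt_def z0 normc_ge0.
(* rotate so that the mean becomes a nonnegative real *)
pose c : R[i] := (normc (cmean F))^-1%:C * (cmean F)^*%C.
have nJ (z : R[i]) : normc (z^*%C) = normc z by case: z => a b /=; rewrite sqrrN.
have cz : Re (c * cmean F) = normc (cmean F).
  rewrite /c -mulrA Re_scale Re_mul; case: (cmean F) z0 zp => a b /= z0 zp.
  rewrite mulNr opprK -!expr2 -[X in _ * X](@sqr_sqrtr _ (a ^+ 2 + b ^+ 2)) ?addr_ge0 ?sqr_ge0//.
  by rewrite expr2 mulKf.
have nc : normc c = 1.
  by rewrite /c ComplexField.Normc.normcM nJ normc_real gtr0_norm ?invr_gt0// mulVf.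
rewrite -cz -cmeanZ//= -[leRHS]mean_cst.
have [c1 _] : ccontinuous (fun x => c * F x) by exact/ccontinuousM/cF/ccontinuous_cst.
apply: le_mean => //; first by move=> x; exact: cst_continuous.
move=> x; rewrite (le_trans (ler_norm _))// (le_trans (Re_le_normc _))//.
by rewrite ComplexField.Normc.normcM nc mul1r.
Qed.

Lemma cmean_shift F (s : R) : ccontinuous F -> periodic1 F -> 0 <= s <= 1 ->
  cmean (fun x => F (x + s)) = cmean F.
Proof.
move=> [F1 F2] pF s01; apply: complex_eq => /=.
  by rewrite (mean_shift F1)// => x; rewrite pF.
by rewrite (mean_shift F2)// => x; rewrite pF.
Qed.

Lemma cmean_dilate F n : ccontinuous F -> periodic1 F -> (0 < n)%N ->
  cmean (fun x => F (n%:R * x)) = cmean F.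
Proof.
move=> [F1 F2] pF s01; apply: complex_eq => /=.
  by rewrite (mean_dilate F1)// => x; rewrite pF.
by rewrite (mean_dilate F2)// => x; rewrite pF.
Qed.

End ComplexMean.

(** * Expectations under the uniform law *)

Section UniformExpectation.
Context (disp : measure_display) (T : measurableType disp) (R : realType).
Variables (P : probability T R) (U : {RV P >-> R}).
Hypothesis U_uniform : uniform01 U.
Local Notation mu := (@lebesgue_measure R).

(** For nonnegative functions the change of variables needs no integrability; the signed case
    follows by positive and negative parts. *)
Lemma ge0_integral_uniform01 (G : R -> \bar R) :
  measurable_fun [set: R] G -> (forall x, 0 <= G x)%E ->
  (\int[P]_w G (U w) = \int[mu]_(x in `[0%R, 1%R]) G x)%E.
Proof.
move=> mG G0.
pose V : T -> measurableTypeR R := U.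
have mV : measurable_fun setT V by move=> _ A mA; exact: (@measurable_funPT _ _ _ _ U measurableT A mA).
rewrite -[LHS](@ge0_integral_pushforward _ _ _ _ _ V mV P setT G)//.
(* The two laws are known to agree on measurable sets, and these are all that the integral sees. *)
rewrite (eq_measure_integral (uniform_prob (@ltr01 R))); last first.
  by move=> A mA _; exact: U_uniform.
by rewrite integral_uniform// subr0 invr1 mul1e.
Qed.

Lemma expectation_uniform01 (h : R -> R) : continuous h ->
  ('E_P[fun w => h (U w)] = (mean h)%:E)%E.
Proof.
move=> ch; have mh : measurable_fun setT (EFin \o h).
  by apply/measurable_EFinP; exact: continuous_measurable_fun.
rewrite unlock /mean /Rintegral fineK; last first.
  apply: integrable_fin_num => //; exact: continuous_integrable_itv.
rewrite [LHS]integralE [RHS]integralE.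
congr (_ - _)%E.
  have := ge0_integral_uniform01 (measurable_funepos mh) (funepos_ge0 _).
  by rewrite !funepos.unlock.
have := ge0_integral_uniform01 (measurable_funeneg mh) (funeneg_ge0 _).
by rewrite !funeneg.unlock.
Qed.

Lemma cexpectation_uniform01 (F : R -> R[i]) : ccontinuous F ->
  cexpectation P (fun w => F (U w)) = cmean F.
Proof.
move=> [F1 F2]; rewrite /cexpectation.
by rewrite (expectation_uniform01 F1) (expectation_uniform01 F2).
Qed.

End UniformExpectation.

(** * Averages over shifts by multiples of 1/a *)

Section ShiftAverage.
Variable R : realType.
Implicit Types (F G H : R -> R[i]).

Definition shift_periodic (a : nat) F := forall x, F (x + a%:R^-1) = F x.

(** On functions of period 1 this is the conditional expectation given [a%:R * x] modulo 1. *)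
Definition shift_avg (a : nat) F (x : R) : R[i] :=
  a%:R^-1 * \sum_(i < a) F (x + i%:R / a%:R).

Definition clipschitz (L : R) F := forall x y, normc (F x - F y) <= L * `|x - y|.

Lemma shift_periodic_mul (a : nat) F n x : shift_periodic a F ->
  F (x + n%:R / a%:R) = F x.
Proof.
move=> pF; elim: n => [|n ih]; first by rewrite mul0r addr0.
by rewrite -natr1 mulrDl mul1r addrA pF.
Qed.

Lemma shift_periodic_dvd (a b : nat) F : (0 < b)%N -> (a %| b)%N ->
  shift_periodic b F -> shift_periodic a F.
Proof.
move=> b0 /dvdnP[q bE] pF x.
rewrite -(@shift_periodic_mul b F q x pF); congr (F (x + _)).
have [a0 q0] : (0 < a)%N /\ (0 < q)%N by move: b0; rewrite bE muln_gt0 => /andP[].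
by rewrite bE natrM invfM mulrA mulfV ?mul1r// pnatr_eq0 -lt0n.
Qed.

Lemma shift_periodic1 (a : nat) F : (0 < a)%N -> shift_periodic a F -> periodic1 F.
Proof.
move=> a0 /(shift_periodic_dvd a0 (dvd1n a)) p1 x.
by rewrite -[in RHS](p1 x) invr1.
Qed.

Lemma shift_periodicM (a : nat) F G : shift_periodic a F -> shift_periodic a G ->
  shift_periodic a (fun x => F x * G x).
Proof. by move=> pF pG x; rewrite pF pG. Qed.

Lemma shift_periodic_dilate (a : nat) F : (0 < a)%N -> periodic1 F ->
  shift_periodic a (fun x => F (a%:R * x)).
Proof.
by move=> a0 pF x; rewrite mulrDr mulfV ?pF// pnatr_eq0 -lt0n.
Qed.

Lemma shift_avg_periodic (a : nat) F : (0 < a)%N -> periodic1 F ->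
  shift_periodic a (shift_avg a F).
Proof.
case: a => // a _ pF x; rewrite /shift_avg; congr (_ * _).
rewrite big_ord_recr [RHS]big_ord_recl /= addrC; congr (_ + _).
  rewrite mul0r addr0 -[in RHS](pF x); congr (F _).
  by rewrite -addrA; congr (_ + _); rewrite -[X in X + _]mul1r -mulrDl nat1r mulfV// pnatr_eq0.
apply: eq_bigr => i _; congr (F _); rewrite -addrA; congr (_ + _).
by rewrite /bump /= add1n -[i.+1%:R]natr1 mulrDl mul1r addrC.
Qed.

Lemma ccontinuous_shift F s : ccontinuous F -> ccontinuous (fun x => F (x + s)).
Proof.
move=> cF; apply: ccontinuous_comp => // x.
by apply: cvgD; [exact: cvg_id|exact: cvg_cst].
Qed.

Lemma shift_avg_continuous (a : nat) F : ccontinuous F -> ccontinuous (shift_avg a F).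
Proof.
move=> cF; apply: ccontinuousM; first exact: ccontinuous_cst.
by apply: ccontinuous_sum => i; exact: ccontinuous_shift.
Qed.

(** A translation by i/a preserves the mean and fixes G, so F may be replaced by each of its
    translates, hence by their average. *)
Lemma cmean_shift_avg (a : nat) F G : (0 < a)%N -> ccontinuous F -> ccontinuous G ->
  periodic1 F -> shift_periodic a G ->
  cmean (fun x => F x * G x) = cmean (fun x => shift_avg a F x * G x).
Proof.
move=> a0 cF cG pF pG.
have a0' : a%:R != 0 :> R[i] by rewrite pnatr_eq0 -lt0n.
under [in RHS]eq_fun do rewrite /shift_avg -mulrA mulr_suml.
rewrite cmeanZ; last first.
  by apply: ccontinuous_sum => i; apply: ccontinuousM => //; exact: ccontinuous_shift.
rewrite cmean_sum; last by move=> i; apply: ccontinuousM => //; exact: ccontinuous_shift.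
rewrite (eq_bigr (fun=> cmean (fun x => F x * G x))).
  by rewrite sumr_const card_ord -[cmean _ *+ a]mulr_natl mulKf.
move=> i _; rewrite -[RHS](@cmean_shift _ _ (i%:R / a%:R)).
- by congr cmean; apply/funext => x; rewrite (shift_periodic_mul _ _ pG).
- exact: ccontinuousM.
- by move=> x; rewrite pF (shift_periodic1 a0 pG).
- rewrite divr_ge0//= ler_pdivrMr ?ltr0n// mul1r ler_nat; exact: ltnW.
Qed.

Lemma shift_avg_lipschitz (a : nat) F L : (0 < a)%N -> clipschitz L F ->
  clipschitz L (shift_avg a F).
Proof.
move=> a0 lF x y; rewrite /shift_avg -mulrBr -sumrB ComplexField.Normc.normcM.
have a0' : 0 < a%:R :> R by rewrite ltr0n.
rewrite -[a%:R](rmorph_nat (real_complex R)) -fmorphV normc_real ger0_norm ?invr_ge0 ?ler0n//.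
rewrite ler_pdivrMl// (le_trans (normc_sum _ _))//.
have -> : a%:R * (L * `|x - y|) = \sum_(i < a) (L * `|x - y|).
  by rewrite sumr_const card_ord mulr_natl.
apply: ler_sum => i _; rewrite (le_trans (lF _ _))//.
by rewrite opprD addrACA subrr addr0.
Qed.

(** Periodicity moves y by a multiple of 1/a to within 1/a of x, where the Lipschitz bound
    applies. *)
Lemma shift_periodic_osc (a : nat) F L : (0 < a)%N -> clipschitz L F ->
  shift_periodic a F -> forall x y, normc (F x - F y) <= L / a%:R.
Proof.
move=> a0 lF pF.
have a0' : 0 < a%:R :> R by rewrite ltr0n.
have L0 : 0 <= L by have := lF 1 0; rewrite subr0 normr1 mulr1; apply: le_trans; exact: normc_ge0.
have key (x y : R) : y <= x -> normc (F x - F y) <= L / a%:R.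
  move=> yx; pose n := Num.truncn ((x - y) * a%:R).
  have := @truncn_itv _ ((x - y) * a%:R); rewrite mulr_ge0 ?subr_ge0 ?ler0n// => /(_ isT).
  rewrite -/n => /andP[n1 n2].
  rewrite -(@shift_periodic_mul a F n y pF) (le_trans (lF _ _))// ler_wpM2l//.
  have nx : n%:R / a%:R <= x - y by rewrite ler_pdivrMr.
  have xn : x - y <= n.+1%:R / a%:R by rewrite ler_pdivlMr// ltW.
  rewrite opprD addrA ger0_norm ?subr_ge0// lerBlDl.
  by rewrite -[X in _ <= _ + X]mul1r -mulrDl natr1.
by move=> x y; case: (leP y x) => [/key//|/ltW /key]; rewrite (normcB (F x)).
Qed.

Lemma normc_sub_cmean F (B : R) : ccontinuous F ->
  (forall x y, normc (F x - F y) <= B) -> forall x, normc (F x - cmean F) <= B.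
Proof.
move=> cF FB x; rewrite -[F x in leLHS]cmean_cst -cmeanB//; last exact: ccontinuous_cst.
apply: normc_cmean_le => [|//].
exact: ccontinuousB (ccontinuous_cst (F x)) cF.
Qed.

End ShiftAverage.

(** * Products along a divisibility chain *)

Section RelativeIncrements.
Variable R : realType.

(** A discrete Gronwall inequality: the induction hypothesis itself bounds [normc (u n)] by the
    exponential of the sum, and [1 + d n <= expR (d n)] absorbs the next step. It serves both the
    means along a divisibility chain and the n-th power of a number close to 1. *)
Lemma normc_relative_increments (u : nat -> R[i]) (d : nat -> R) n :
  u 0%N = 1 -> (forall k, 0 <= d k) ->
  (forall k, (k < n)%N -> normc (u k.+1 - u k) <= d k * normc (u k)) ->
  normc (u n - 1) <= expR (\sum_(k < n) d k) - 1.
Proof.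
move=> u0 d0; elim: n => [|n ih] du.
  by rewrite u0 subrr ComplexField.Normc.normc0 big_ord0 expR0 subrr.
rewrite big_ord_recr /= expRD.
have {}ih := ih (fun k kn => du k (ltnW kn)).
set s := expR (\sum_(k < n) d k) in ih *.
have un : normc (u n) <= s.
  rewrite -[u n](subrK 1) (le_trans (normcD _ _))// ComplexField.Normc.normc1.
  by rewrite -lerBrDr.
rewrite (le_trans (normc_distD _ (u n) _))//.
have h1 : normc (u n.+1 - u n) <= d n * s.
  by rewrite (le_trans (du n _))// ler_wpM2l.
rewrite (le_trans (lerD h1 ih))//.
have : s * (1 + d n) <= s * expR (d n) by rewrite ler_wpM2l ?expR_ge0// expR_ge1Dx.
lra.
Qed.

End RelativeIncrements.

Section DivisibleProducts.
Variable R : realType.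
Variables (g : R -> R[i]) (eta : R) (b : nat -> nat).
Hypothesis g_cont : ccontinuous g.
Hypothesis g_per : periodic1 g.
Hypothesis g_mean : cmean g = 1.
Hypothesis g_close : forall x, normc (g x - 1) <= eta.
Hypothesis g_lip : clipschitz eta g.
Hypothesis eta_le : eta <= 1 / 10.
Hypothesis b_gt0 : forall k, (0 < b k)%N.
Hypothesis b_dvd : forall k, (b k %| b k.+1)%N.
Hypothesis b_double : forall k, (2 * b k <= b k.+1)%N.

Definition dilated_prod k (x : R) : R[i] := \prod_(j < k) g ((b j)%:R * x).

(** The value 0 at k = 0 fits the empty product, which is constant: its Lipschitz constant is 0 and
    the first step does not change the mean. *)
Definition prev_freq k := if k is k'.+1 then b k' else 0%N.

(* The conditional expectation of [dilated_prod k] given [b k * x] modulo 1. *)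
Fixpoint cond_prod k : R -> R[i] :=
  if k is k'.+1 then
    shift_avg (b k) (fun x => cond_prod k' x * g ((b k')%:R * x))
  else fun=> 1.

Let mu k := cmean (cond_prod k).

Let eta_ge0 : 0 <= eta.
Proof. exact: le_trans (normc_ge0 _) (g_close 0). Qed.

Lemma ccontinuous_dilate (F : R -> R[i]) (a : R) : ccontinuous F ->
  ccontinuous (fun x => F (a * x)).
Proof.
move=> cF; apply: ccontinuous_comp => // x.
by apply: cvgM; [exact: cvg_cst|exact: cvg_id].
Qed.

Lemma dilated_prod_continuous k : ccontinuous (dilated_prod k).
Proof.
elim: k => [|k ih]; rewrite /dilated_prod.
  by under eq_fun do rewrite big_ord0; exact: ccontinuous_cst.
under eq_fun do rewrite big_ord_recr /=.
by apply: ccontinuousM => //; exact: ccontinuous_dilate.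
Qed.

Lemma cond_prod_continuous k : ccontinuous (cond_prod k).
Proof.
elim: k => [|k ih] /=; first exact: ccontinuous_cst.
by apply: shift_avg_continuous; apply: ccontinuousM => //; exact: ccontinuous_dilate.
Qed.

Lemma cond_prod_periodic k : shift_periodic (b k) (cond_prod k).
Proof.
elim: k => [|k ih] //=; apply: shift_avg_periodic => //.
apply: (@shift_periodic1 _ (b k)) => //.
by apply: shift_periodicM => //; exact: shift_periodic_dilate.
Qed.

(** A test function of period [1 / b k.+1] also has period [1 / b k] by divisibility. So the last
    factor of the product can be moved into the test function before the induction hypothesis is
    applied. *)
Lemma cmean_cond_prod k (Q : R -> R[i]) : ccontinuous Q -> shift_periodic (b k) Q ->
  cmean (fun x => dilated_prod k x * Q x) = cmean (fun x => cond_prod k x * Q x).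
Proof.
elim: k Q => [|k ih] Q cQ pQ.
  by rewrite /dilated_prod; under eq_fun do rewrite big_ord0.
have pQk : shift_periodic (b k) (fun x => g ((b k)%:R * x) * Q x).
  apply: shift_periodicM; first exact: shift_periodic_dilate.
  exact: shift_periodic_dvd pQ.
have cg : ccontinuous (fun x => g ((b k)%:R * x)) by exact: ccontinuous_dilate.
transitivity (cmean (fun x => dilated_prod k x * (g ((b k)%:R * x) * Q x))).
  congr cmean; apply/funext => x.
  by rewrite mulrA /dilated_prod big_ord_recr.
rewrite ih//; last exact: ccontinuousM.
rewrite -cmean_shift_avg//.
- by congr cmean; apply/funext => x; rewrite mulrA.
- by apply: ccontinuousM => //; exact: cond_prod_continuous.
- apply: (@shift_periodic1 _ (b k)) => //.
  apply: shift_periodicM; first exact: cond_prod_periodic.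
  exact: shift_periodic_dilate.
Qed.

Lemma cmean_dilated_prod k : cmean (dilated_prod k) = mu k.
Proof.
have := @cmean_cond_prod k (fun=> 1) (ccontinuous_cst 1) (fun x => erefl).
by under eq_fun do rewrite mulr1; under [in RHS]eq_fun do rewrite mulr1.
Qed.

Lemma cond_prod_step k : mu k.+1 = cmean (fun x => cond_prod k x * g ((b k)%:R * x)).
Proof.
rewrite -cmean_dilated_prod -cmean_cond_prod.
- by congr cmean; apply/funext => x; rewrite /dilated_prod big_ord_recr.
- exact: ccontinuous_dilate.
- exact: shift_periodic_dilate.
Qed.

Lemma g_dilate_mean k : cmean (fun x => g ((b k)%:R * x)) = 1.
Proof. by rewrite cmean_dilate. Qed.

Lemma normc_g_le x : normc (g x) <= 1 + eta.
Proof.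
rewrite -[g x](subrK 1) (le_trans (normcD _ _))// ComplexField.Normc.normc1.
by rewrite addrC lerD2l.
Qed.

(** Since [g] dilated by [b k] has mean 1, the increment is the mean of the product of two centred
    factors. The first is bounded by the oscillation of [cond_prod k], the second by [eta]; this
    additional [eta] makes the final error quadratic in [eta]. *)
Lemma cond_mean_increment k l : clipschitz l (cond_prod k) ->
  normc (mu k.+1 - mu k) <= eta * (l / (b k)%:R).
Proof.
move=> lH.
have cH := cond_prod_continuous k.
have cg : ccontinuous (fun x => g ((b k)%:R * x)) by exact: ccontinuous_dilate.
have osc x : normc (cond_prod k x - mu k) <= l / (b k)%:R.
  apply: normc_sub_cmean => //; apply: shift_periodic_osc => //.
  exact: cond_prod_periodic.
have cHm : ccontinuous (fun x => cond_prod k x - mu k).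
  exact: ccontinuousB (ccontinuous_cst _).
have cg1 : ccontinuous (fun x => g ((b k)%:R * x) - 1).
  exact: ccontinuousB (ccontinuous_cst _).
have -> : mu k.+1 - mu k =
    cmean (fun x => (cond_prod k x - mu k) * (g ((b k)%:R * x) - 1)).
  under eq_fun do rewrite mulrBr mulr1.
  rewrite cmeanB ?[X in _ = _ - X]cmeanB ?cmean_cst//; last 2 first.
  - exact: ccontinuous_cst.
  - exact: ccontinuousM.
  under eq_fun do rewrite mulrBl.
  rewrite cmeanB; last 2 first.
  - exact: ccontinuousM.
  - by apply: ccontinuousM => //; exact: ccontinuous_cst.
  rewrite cmeanZ// g_dilate_mean -cond_prod_step mulr1 subrr subr0//.
apply: normc_cmean_le; first exact: ccontinuousM.
move=> x; rewrite ComplexField.Normc.normcM mulrC.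
by rewrite ler_pM ?normc_ge0.
Qed.

Let mu0 : mu 0%N = 1.
Proof. exact: cmean_cst. Qed.

(** Doubling turns [6 * prev_freq k] into at most [3 * b k]. Multiplication by the next factor then
    gives Lipschitz constant [eta * b k * (4 + 6 * eta)] times the old modulus of the mean, while
    the new modulus is at least [1 - 3 * eta ^+ 2] times the old one. *)
Lemma cond_prod_lipschitz k :
  0 < normc (mu k) /\
  clipschitz (6 * eta * (prev_freq k)%:R * normc (mu k)) (cond_prod k).
Proof.
elim: k => [|k [mk lk]].
  rewrite mu0 ComplexField.Normc.normc1 ltr01; split=> // x y.
  by rewrite subrr ComplexField.Normc.normc0 mulr0 !mul0r.
set m := normc (mu k) in mk lk *.
have b0 : 0 < (b k)%:R :> R by rewrite ltr0n.
have pb : 2 * (prev_freq k)%:R <= (b k)%:R :> R.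
  by case: (k) => [|j]; rewrite -natrM ler_nat ?muln0//; exact: b_double.
have lk' : 6 * eta * (prev_freq k)%:R * m <= 3 * eta * (b k)%:R * m.
  rewrite ler_wpM2r ?(ltW mk)//.
  have : eta * (2 * (prev_freq k)%:R) <= eta * (b k)%:R by rewrite ler_wpM2l.
  lra.
have {}lk : clipschitz (3 * eta * (b k)%:R * m) (cond_prod k).
  by move=> x y; rewrite (le_trans (lk x y))// ler_wpM2r.
have mu1 : (1 - 3 * eta ^+ 2) * m <= normc (mu k.+1).
  have := cond_mean_increment lk.
  have -> : eta * (3 * eta * (b k)%:R * m / (b k)%:R) = 3 * eta ^+ 2 * m.
    by field; rewrite gt_eqF.
  rewrite normcB => h; have := le_trans (normc_subr _ _) h; rewrite -/m; lra.
have H_le x : normc (cond_prod k x) <= (1 + 3 * eta) * m.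
  have := normc_sub_cmean (cond_prod_continuous k)
    (shift_periodic_osc (b_gt0 k) lk (cond_prod_periodic k)) x.
  have -> : 3 * eta * (b k)%:R * m / (b k)%:R = 3 * eta * m.
    by field; rewrite gt_eqF.
  move=> h; have := le_trans (normc_subr _ _) h; rewrite -/(mu k) -/m; lra.
split.
  apply: lt_le_trans mu1; apply: mulr_gt0 => //.
  have : eta ^+ 2 <= 1 / 10 * (1 / 10) by rewrite expr2 ler_pM.
  lra.
apply: shift_avg_lipschitz => // x y /=.
have -> : cond_prod k x * g ((b k)%:R * x) - cond_prod k y * g ((b k)%:R * y) =
   (cond_prod k x - cond_prod k y) * g ((b k)%:R * x) +
   cond_prod k y * (g ((b k)%:R * x) - g ((b k)%:R * y)) by ring.
rewrite (le_trans (normcD _ _))// !ComplexField.Normc.normcM.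
have t1 : normc (cond_prod k x - cond_prod k y) * normc (g ((b k)%:R * x)) <=
    3 * eta * (b k)%:R * m * `|x - y| * (1 + eta).
  by rewrite ler_pM ?normc_ge0 ?normc_g_le.
have t2 : normc (cond_prod k y) * normc (g ((b k)%:R * x) - g ((b k)%:R * y)) <=
    (1 + 3 * eta) * m * (eta * ((b k)%:R * `|x - y|)).
  rewrite ler_pM ?normc_ge0// (le_trans (g_lip _ _))// -mulrBr normrM.
  by rewrite (gtr0_norm b0).
rewrite (le_trans (lerD t1 t2))//.
have -> : 3 * eta * (b k)%:R * m * `|x - y| * (1 + eta) +
    (1 + 3 * eta) * m * (eta * ((b k)%:R * `|x - y|)) =
    (eta * (b k)%:R * ((4 + 6 * eta) * m)) * `|x - y| by ring.
rewrite ler_wpM2r//.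
have -> : 6 * eta * (b k)%:R * normc (mu k.+1) = eta * (b k)%:R * (6 * normc (mu k.+1)).
  by ring.
rewrite ler_wpM2l ?mulr_ge0 ?ler0n//.
(* The constant 6 reproduces itself because [4 + 6 * eta <= 6 * (1 - 3 * eta ^+ 2)] for eta in
   [0, 1/10]. *)
have : 6 * ((1 - 3 * eta ^+ 2) * m) <= 6 * normc (mu k.+1) by rewrite ler_wpM2l.
apply: le_trans; rewrite mulrA ler_wpM2r ?(ltW mk)//.
have : eta ^+ 2 <= 1 / 10 * (1 / 10) by rewrite expr2 ler_pM.
by move: eta_le; lra.
Qed.

Lemma dilated_prod_divisible n :
  normc (cmean (dilated_prod n) - 1) <=
  expR (\sum_(k < n) (6 * eta ^+ 2 * ((prev_freq k)%:R / (b k)%:R))) - 1.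
Proof.
rewrite cmean_dilated_prod.
apply: (@normc_relative_increments _ mu (fun k => 6 * eta ^+ 2 * ((prev_freq k)%:R / (b k)%:R))).
- exact: mu0.
- by move=> k; rewrite mulr_ge0 ?divr_ge0 ?ler0n// mulr_ge0 ?sqr_ge0 ?ler0n.
- move=> k _; have [_ lk] := cond_prod_lipschitz k.
  rewrite (le_trans (cond_mean_increment lk))// le_eqVlt; apply/orP; left.
  by apply/eqP; field; rewrite pnatr_eq0 -lt0n.
Qed.

End DivisibleProducts.

(** * Trigonometric polynomials *)

Section TrigonometricPolynomials.
Variable R : realType.
Implicit Types (F G : R -> R[i]) (m : int) (x y : R).

(** The exponential is written exactly as in [trig_poly], so that the terms of the latter are
    recognised by conversion. *)
Definition char m x : R[i] := cexp (0 +i* (2 * pi * m%:~R * x)).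

Lemma charD m x y : char m (x + y) = char m x * char m y.
Proof.
rewrite /char -cexpD; congr cexp; apply: complex_eq => /=; ring.
Qed.

Lemma charDm m m' x : char (m + m') x = char m x * char m' x.
Proof.
rewrite /char -cexpD; congr cexp; apply: complex_eq => /=; first ring.
by rewrite intrD; ring.
Qed.

Lemma char0 x : char 0 x = 1.
Proof. by rewrite /char mulr0 mul0r cexp0. Qed.

Lemma char_x0 m : char m 0 = 1.
Proof. by rewrite /char mulr0 cexp0. Qed.

Lemma char_muln m n x : char m (n%:R * x) = char (m * n%:Z) x.
Proof.
by rewrite /char intrM -pmulrn; congr cexp; apply: complex_eq => //=; ring.
Qed.

Lemma charX m n x : char m (n%:R * x) = char m x ^+ n.
Proof.
elim: n => [|n ih]; first by rewrite mul0r char_x0.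
by rewrite -natr1 mulrDl mul1r charD ih exprS mulrC.
Qed.

Lemma normc_char m x : normc (char m x) = 1.
Proof. by rewrite normc_cexp expR0. Qed.

Lemma char_1 m : char m 1 = 1.
Proof.
have cn (n : nat) : char n%:Z 1 = 1.
  elim: n => [|n ih]; first exact: char0.
  rewrite -addn1 PoszD charDm ih mul1r /char mulr1 mulr1 /cexp /=.
  by rewrite (mulr_natl pi) cos2pi sin2pi expR0 mulr1 mulr0.
case: (intP m) => [|n|n]; [exact: char0|exact: cn|].
have := charDm n.+1 (- n.+1%:Z) 1.
by rewrite addrN char0 cn mul1r.
Qed.

Lemma char_periodic m : periodic1 (char m).
Proof. by move=> x; rewrite charD char_1 mulr1. Qed.

Lemma cos_lt1 (t : R) : 0 < t < 2 * pi -> cos t < 1.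
Proof.
move=> /andP[t0 t1]; have -> : t = (t / 2) *+ 2 by rewrite -mulr_natr divfK.
rewrite cos_mulr2n; have s0 : 0 < sin (t / 2).
  by apply: sin_gt0_pi; rewrite divr_gt0//= ltr_pdivrMr// mulrC.
have := cos2Dsin2 (t / 2); have : 0 < sin (t / 2) ^+ 2 by rewrite exprn_gt0.
lra.
Qed.

(** The real part is the cosine of an angle whose absolute value lies strictly between 0 and 2
    pi. *)
Lemma char_neq1 m (a : nat) : m != 0 -> (`|m| < a)%N -> char m a%:R^-1 != 1.
Proof.
move=> m0 ma; have a0 : 0 < a%:R :> R by rewrite ltr0n (leq_ltn_trans _ ma).
apply/eqP => /(congr1 (@complex.Re R)); rewrite /char /cexp /= expR0 mul1r => c1.
have pi0 := @pi_gt0 R.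
suff : cos (2 * pi * (`|m|%N%:R / a%:R)) = 1 :> R.
  apply/eqP; rewrite lt_eqF// cos_lt1//; apply/andP; split.
    by rewrite !mulr_gt0 ?invr_gt0// ltr0n lt0n absz_eq0.
  by rewrite -[ltRHS]mulr1 ltr_pM2l ?mulr_gt0// ltr_pdivrMr// mul1r ltr_nat.
rewrite -[RHS]c1; have [m_ge0|m_lt0] := leP 0 m.
  by rewrite -[m in RHS]gez0_abs// -pmulrn mulrA.
rewrite -cosN -[m in RHS](opprK m) -[- m]ltz0_abs//.
by rewrite mulrNz -pmulrn; congr cos; ring.
Qed.

Lemma char_sum_eq0 m (a : nat) : m != 0 -> (`|m| < a)%N ->
  \sum_(i < a) char m (i%:R / a%:R) = 0.
Proof.
move=> m0 ma; have a0 : a%:R != 0 :> R by rewrite pnatr_eq0 -lt0n (leq_ltn_trans _ ma).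
have w1 := char_neq1 m0 ma; set w := char m a%:R^-1 in w1.
have wa : w ^+ a = 1 by rewrite /w -charX mulfV// char_1.
have : (w - 1) * (\sum_(i < a) w ^+ i) = 0 by rewrite -subrX1 wa subrr.
move/eqP; rewrite mulf_eq0 subr_eq0 (negbTE w1) /= => /eqP E.
by rewrite -[RHS]E; apply: eq_bigr => i _; rewrite charX.
Qed.

Lemma char_continuous m : ccontinuous (char m).
Proof.
apply: ccontinuous_cexp; split => x /=; first exact: cst_continuous.
by apply: cvgM; [exact: cvg_cst|exact: cvg_id].
Qed.

(** Trigonometric polynomials with frequencies at most N in absolute value. They are generated by
    characters and sums, not presented by a coefficient family, so that closure under products,
    dilations and averages goes by induction. *)
Inductive trigp (N : nat) : (R -> R[i]) -> Prop :=
| trigp_char (c : R[i]) m : (`|m| <= N)%N -> trigp N (fun x => c * char m x)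
| trigp_add F G : trigp N F -> trigp N G -> trigp N (fun x => F x + G x).

Lemma trigp_cst N (c : R[i]) : trigp N (fun=> c).
Proof.
have := @trigp_char N c 0 (leq0n _).
by under eq_fun do rewrite char0 mulr1.
Qed.

Lemma trigp_mono N M F : (N <= M)%N -> trigp N F -> trigp M F.
Proof.
move=> NM; elim=> [c m mN|F' G' _ h1 _ h2]; last exact: trigp_add.
exact/trigp_char/(leq_trans mN).
Qed.

Lemma trigp_mul N M F G : trigp N F -> trigp M G ->
  trigp (N + M) (fun x => F x * G x).
Proof.
move=> tF; elim: tF G => {F} [c m mN|F1 F2 _ h1 _ h2] G tG; last first.
  under eq_fun do rewrite mulrDl.
  by apply: trigp_add; [exact: h1|exact: h2].
elim: tG => [d k kM|G1 G2 _ h1 _ h2].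
  under eq_fun do rewrite mulrACA -charDm.
  apply: trigp_char; apply: leq_trans (leq_add mN kM).
  by rewrite -lez_nat PoszD !abszE ler_normD.
by under eq_fun do rewrite mulrDr; exact: trigp_add.
Qed.

Lemma trigpX N F p : trigp N F -> trigp (p * N) (fun x => F x ^+ p).
Proof.
move=> tF; elim: p => [|p ih]; first exact: trigp_cst.
by rewrite mulSn; under eq_fun do rewrite exprS; exact: trigp_mul.
Qed.

Lemma trigp_sum N (I : Type) (r : seq I) (P : pred I) (F : I -> R -> R[i]) :
  (forall i, P i -> trigp N (F i)) -> trigp N (fun x => \sum_(i <- r | P i) F i x).
Proof.
move=> tF; elim: r => [|i r ih].
  by under eq_fun do rewrite big_nil; exact: trigp_cst.
under eq_fun do rewrite big_cons.
case Pi: (P i) => //; apply: trigp_add => //; exact: tF.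
Qed.

Lemma trigpZ N (c : R[i]) F : trigp N F -> trigp N (fun x => c * F x).
Proof. by move=> tF; exact: (trigp_mul (trigp_cst 0 c) tF). Qed.

Lemma trigp_dilate N a F : trigp N F -> trigp (a * N) (fun x => F (a%:R * x)).
Proof.
elim=> [c m mN|F1 F2 _ h1 _ h2]; last exact: trigp_add.
under eq_fun do rewrite char_muln.
by apply: trigp_char; rewrite abszM mulnC leq_mul.
Qed.

Lemma trigp_continuous N F : trigp N F -> ccontinuous F.
Proof.
elim=> [c m mN|F1 F2 _ h1 _ h2]; last exact: ccontinuousD.
apply: ccontinuousM; [exact: ccontinuous_cst|exact: char_continuous].
Qed.

Lemma trigp_periodic N F : trigp N F -> periodic1 F.
Proof.
by elim=> [c m mN|F1 F2 _ h1 _ h2] x; rewrite ?char_periodic// h1 h2.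
Qed.

(** A nonzero frequency m with |m| < a averages to a full sum of powers of an a-th root of unity
    other than 1, which is 0; only frequency 0 survives. *)
Lemma trigp_shift_avg N (a : nat) F : (N < a)%N -> trigp N F ->
  exists c, forall x, shift_avg a F x = c.
Proof.
move=> Na; have a0 : a%:R != 0 :> R[i] by rewrite pnatr_eq0 -lt0n (leq_ltn_trans _ Na).
elim=> [c m mN|F1 F2 _ [c1 h1] _ [c2 h2]]; last first.
  by exists (c1 + c2) => x; rewrite -(h1 x) -(h2 x) /shift_avg -mulrDr -big_split.
have [->|m0] := eqVneq m 0.
  exists c => x; rewrite /shift_avg; under eq_bigr do rewrite char0 mulr1.
  by rewrite sumr_const card_ord -[c *+ a]mulr_natl mulKf.
exists 0 => x; rewrite /shift_avg; under eq_bigr do rewrite charD.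
by rewrite -mulr_sumr -mulr_sumr char_sum_eq0 ?mulr0// (leq_ltn_trans mN).
Qed.

(** A shift by [1 / (|m| + 1)] preserves the mean and multiplies it by a number other than 1. *)
Lemma cmean_char m : m != 0 -> cmean (char m) = 0.
Proof.
move=> m0; have w1 := char_neq1 m0 (ltnSn `|m|).
have s01 : 0 <= (`|m|.+1%:R^-1 : R) <= 1.
  by rewrite invr_ge0 ler0n/= invf_le1 ?ltr0n// ler1n.
have := cmean_shift (char_continuous m) (@char_periodic m) s01.
under eq_fun do rewrite charD mulrC.
rewrite cmeanZ; last exact: char_continuous.
move=> E; have /eqP : (char m `|m|.+1%:R^-1 - 1) * cmean (char m) = 0.
  by rewrite mulrBl E mul1r subrr.
by rewrite mulf_eq0 subr_eq0 (negbTE w1) => /eqP.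
Qed.

(** A bound linear in t on the whole line: Taylor for |t| <= 1, and the trivial bound 2 beyond. *)
Lemma normc_cexp_sub1_im (t : R) :
  normc (cexp (0 +i* t) - 1) <= 2 * expR 1 * `|t|.
Proof.
have e1 : 1 <= expR 1 :> R by rewrite -expR0 ler_expR.
have [t1|t1] := leP `|t| 1.
  have := cexp_sub1 (0 +i* t).
  have -> : normc (0 +i* t) = `|t| by rewrite /= expr0n add0r sqrtr_sqr.
  move=> /le_trans; apply; rewrite -mulrA -[leRHS]mulrA ler_wpM2l// mulrC.
  by rewrite ler_wpM2r// ler_expR.
rewrite (le_trans (normcD _ _))// normcN normc_cexp expR0 ComplexField.Normc.normc1.
have : 1 * 1 <= expR 1 * `|t| by rewrite ler_pM// ltW.
lra.
Qed.

Lemma trigp_lipschitz N F : trigp N F -> exists2 L, 0 <= L & clipschitz L F.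
Proof.
elim=> [c m mN|F1 F2 _ [L1 L10 h1] _ [L2 L20 h2]]; last first.
  exists (L1 + L2); first exact: addr_ge0.
  move=> x y; rewrite opprD addrACA (le_trans (normcD _ _))// mulrDl.
  by rewrite lerD.
exists (normc c * (2 * expR 1 * `|2 * pi * m%:~R|)).
  by rewrite !mulr_ge0 ?normc_ge0 ?expR_ge0.
move=> x y; rewrite -mulrBr ComplexField.Normc.normcM -!mulrA ler_wpM2l ?normc_ge0//.
have -> : char m x - char m y = char m y * (char m (x - y) - 1).
  by rewrite mulrBr mulr1 -charD addrCA subrr addr0.
rewrite ComplexField.Normc.normcM normc_char mul1r (le_trans (normc_cexp_sub1_im _))//.
by rewrite !normrM -!mulrA.
Qed.

Lemma trigp_bounded N F : trigp N F -> exists2 B, 0 <= B & forall x, normc (F x) <= B.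
Proof.
elim=> [c m mN|F1 F2 _ [L1 L10 h1] _ [L2 L20 h2]]; last first.
  exists (L1 + L2); first exact: addr_ge0.
  by move=> x; rewrite (le_trans (normcD _ _))// lerD.
by exists (normc c) => [|x]; rewrite ?normc_ge0// ComplexField.Normc.normcM normc_char mulr1.
Qed.

End TrigonometricPolynomials.

(** * Products along a sequence with large gaps *)

Section ExpBounds.
Variable R : realType.

Lemma expR_le_inv (x : R) : x < 1 -> expR x <= (1 - x)^-1.
Proof.
move=> x1; rewrite -[x in leLHS]opprK expRN lef_pV2 ?posrE ?expR_gt0 ?subr_gt0//.
exact: expR_ge1Dx.
Qed.

Lemma expR_le2 (x : R) : x <= 1 / 2 -> expR x <= 2.
Proof.
move=> x2; apply: (@le_trans _ _ (expR (1 / 2))); first by rewrite ler_expR.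
apply: le_trans (expR_le_inv _) _; first by lra.
by rewrite -[leRHS]invrK lef_pV2 ?posrE ?invr_gt0//; lra.
Qed.

Lemma pow_fact_le_expR (x : R) n : 0 <= x -> x ^+ n / n`!%:R <= expR x.
Proof.
case: n => [|n] x0; first by rewrite expr0 divr1 -expR0 ler_expR.
have := expR_ge1Dxn n x0; apply: le_trans; rewrite lerDr//.
Qed.

End ExpBounds.

Section TiltedFactor.
Variables (R : realType) (D : nat) (f : R -> R) (M : R).
Hypothesis f_trig : trigp D (fun x => (f x)%:C).
Hypothesis M_gt0 : 0 < M.
Hypothesis f_bound : forall x, `|f x| <= M.
Hypothesis f_lip : forall x y, `|f x - f y| <= M * `|x - y|.

Definition cmgf (l : R[i]) : R[i] := cmean (fun x => cexp (l * (f x)%:C)).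

(** The exponential change of measure of parameter l, complex valued. It is the zero function when
    [cmgf l = 0], which smallness of l excludes. *)
Definition tilted (l : R[i]) (x : R) : R[i] := cexp (l * (f x)%:C) / cmgf l.

Lemma cexp_f_continuous (l : R[i]) : ccontinuous (fun x => cexp (l * (f x)%:C)).
Proof.
apply: ccontinuous_cexp; apply: ccontinuousM; first exact: ccontinuous_cst.
exact: trigp_continuous f_trig.
Qed.

Lemma f_periodic : periodic1 f.
Proof. by move=> x; have /complexI := trigp_periodic f_trig x. Qed.

Lemma tilted_continuous (l : R[i]) : ccontinuous (tilted l).
Proof.
apply: ccontinuousM; [exact: cexp_f_continuous|exact: ccontinuous_cst].
Qed.

Lemma tilted_periodic (l : R[i]) : periodic1 (tilted l).
Proof. by move=> x; rewrite /tilted f_periodic. Qed.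

Lemma normc_lf (l : R[i]) x : normc (l * (f x)%:C) <= normc l * M.
Proof.
by rewrite ComplexField.Normc.normcM normc_real ler_wpM2l ?normc_ge0.
Qed.

Section SmallParameter.
Variable l : R[i].
Hypothesis l_small : normc l * M <= 1 / 160.
Let lM_ge0 : 0 <= normc l * M.
Proof. by rewrite mulr_ge0 ?normc_ge0// ltW. Qed.

Lemma cexp_f_sub1 x : normc (cexp (l * (f x)%:C) - 1) <= 4 * (normc l * M).
Proof.
rewrite (le_trans (cexp_sub1 _))//.
have -> : 4 * (normc l * M) = 2 * (normc l * M) * 2 by ring.
have h := normc_lf l x.
rewrite ler_pM ?mulr_ge0 ?normc_ge0 ?expR_ge0 ?ler_wpM2l//.
apply: expR_le2; move: l_small; lra.
Qed.

Lemma cmgf_sub1 : normc (cmgf l - 1) <= 4 * (normc l * M).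
Proof.
have cf := cexp_f_continuous l.
rewrite /cmgf -[1](@cmean_cst R) -cmeanB//; last exact: ccontinuous_cst.
apply: normc_cmean_le; last exact: cexp_f_sub1.
exact: ccontinuousB (ccontinuous_cst _).
Qed.

Lemma normc_cmgf_ge : 1 / 2 <= normc (cmgf l).
Proof.
have := cmgf_sub1; rewrite normcB => h.
have := le_trans (normc_subr 1 (cmgf l)) h; rewrite ComplexField.Normc.normc1; move: l_small; lra.
Qed.

Lemma cmgf_neq0 : cmgf l != 0.
Proof.
apply/eqP => E; have := normc_cmgf_ge; rewrite E ComplexField.Normc.normc0; move: l_small; lra.
Qed.

Lemma normc_cmgf_inv : normc (cmgf l)^-1 <= 2.
Proof.
rewrite ComplexField.Normc.normcV -[leRHS]invrK lef_pV2 ?posrE ?invr_gt0//.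
  by have := normc_cmgf_ge; move: l_small; lra.
by have := normc_cmgf_ge; move: l_small; lra.
Qed.

Lemma cmean_tilted : cmean (tilted l) = 1.
Proof.
rewrite /tilted; under eq_fun do rewrite mulrC.
rewrite cmeanZ; last exact: cexp_f_continuous.
by rewrite mulVf// cmgf_neq0.
Qed.

(** The constant is 16 = (4 + 4) * 2: both the exponential and its mean are within
    [4 * (normc l * M)] of 1, and the inverse of the mean has modulus at most 2. *)
Lemma tilted_sub1 x : normc (tilted l x - 1) <= 16 * (normc l * M).
Proof.
have -> : tilted l x - 1 = (cexp (l * (f x)%:C) - cmgf l) * (cmgf l)^-1.
  by rewrite mulrBl mulfV// cmgf_neq0.
rewrite ComplexField.Normc.normcM.
have h1 : normc (cexp (l * (f x)%:C) - cmgf l) <= 8 * (normc l * M).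
  rewrite (le_trans (normc_distD _ 1 _))//.
  have := cexp_f_sub1 x; have := cmgf_sub1; rewrite (normcB (cmgf l) 1); move: l_small; lra.
have -> : 16 * (normc l * M) = 8 * (normc l * M) * 2 by ring.
by rewrite ler_pM ?normc_ge0 ?normc_cmgf_inv.
Qed.

(** Factoring out the value at y leaves [cexp] of the difference minus 1. The four factors 2 in 16
    come from the exponential at y, the two constants in [cexp_sub1], and the inverse of
    [cmgf l]. *)
Lemma tilted_lipschitz : clipschitz (16 * (normc l * M)) (tilted l).
Proof.
move=> x y; rewrite /tilted -mulrBl ComplexField.Normc.normcM.
have -> : 16 * (normc l * M) * `|x - y| = 8 * (normc l * M) * `|x - y| * 2 by ring.
rewrite ler_pM ?normc_ge0 ?normc_cmgf_inv//.
have -> : cexp (l * (f x)%:C) - cexp (l * (f y)%:C) =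
    cexp (l * (f y)%:C) * (cexp (l * (f x - f y)%:C) - 1).
  by rewrite mulrBr mulr1 -cexpD -mulrDr -rmorphD /= addrCA subrr addr0.
rewrite ComplexField.Normc.normcM.
have nxy : normc (l * (f x - f y)%:C) <= normc l * M * `|x - y|.
  by rewrite ComplexField.Normc.normcM normc_real -mulrA ler_wpM2l ?normc_ge0.
have nxy2 : normc (l * (f x - f y)%:C) <= 2 * (normc l * M).
  rewrite rmorphB /= mulrBr (le_trans (normcD _ _))// normcN.
  have := normc_lf l x; have := normc_lf l y; move: l_small; lra.
have -> : 8 * (normc l * M) * `|x - y| = 2 * ((2 * (normc l * M * `|x - y|)) * 2) by ring.
rewrite ler_pM ?normc_ge0//.
  rewrite (le_trans (normc_cexp_le _))// expR_le2//.
  have := normc_lf l y; move: l_small; lra.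
rewrite (le_trans (cexp_sub1 _))// ler_pM ?mulr_ge0 ?normc_ge0 ?expR_ge0 ?ler_wpM2l//.
apply: expR_le2; move: l_small; lra.
Qed.

Lemma prod_tilted (b : nat -> nat) k x :
  dilated_prod (tilted l) b k x =
  cexp (l * (\sum_(j < k) f ((b j)%:R * x))%:C) / cmgf l ^+ k.
Proof.
rewrite /dilated_prod /tilted big_split /= -cexp_sum -mulr_sumr rmorph_sum /=.
by rewrite prodr_const card_ord exprVn.
Qed.

Section LargeGaps.
Variables (b : nat -> nat) (K0 : nat).
Hypothesis b_gt0 : forall k, (0 < b k)%N.
Hypothesis b_gap : forall k, (K0 <= k)%N ->
  forall j, (j < k)%N -> (k * (D * b j) < b k)%N.

Let g := tilted l.
Let eta := 16 * (normc l * M).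

Let eta_ge0 : 0 <= eta. Proof. by rewrite mulr_ge0. Qed.

Let incr k := cmean (fun x => dilated_prod g b k x * (g ((b k)%:R * x) - 1)).

Let g_dil_cont k : ccontinuous (fun x => g ((b k)%:R * x) - 1).
Proof.
apply: ccontinuousB (ccontinuous_cst _).
exact/ccontinuous_dilate/tilted_continuous.
Qed.

Let prod_cont k : ccontinuous (dilated_prod g b k).
Proof. exact/dilated_prod_continuous/tilted_continuous. Qed.

Lemma dilated_prod_incr k :
  cmean (dilated_prod g b k.+1) - cmean (dilated_prod g b k) = incr k.
Proof.
rewrite -cmeanB//; congr cmean; apply/funext => x.
by rewrite mulrBr mulr1 /dilated_prod big_ord_recr.
Qed.

(** Meant for the finitely many k below [K0]: every factor has modulus at most 1 + 1/10. *)
Lemma incr_le_crude k : normc (incr k) <= eta * 2 ^+ k.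
Proof.
apply: normc_cmean_le => [|x]; first exact: ccontinuousM.
rewrite ComplexField.Normc.normcM mulrC ler_pM ?normc_ge0 ?tilted_sub1//.
rewrite /dilated_prod; elim: k => [|k ih].
  by rewrite big_ord0 ComplexField.Normc.normc1 expr0.
rewrite big_ord_recr /= ComplexField.Normc.normcM exprSr ler_pM ?normc_ge0//.
rewrite -[g _](subrK 1) (le_trans (normcD _ _))// ComplexField.Normc.normc1.
have := tilted_sub1 ((b k)%:R * x); rewrite -/g; move: l_small; lra.
Qed.

(** The exponential of the first k terms is replaced by its Taylor polynomial [T] of order below k,
    whose frequencies stay below [b k] and which is therefore orthogonal to the centred new factor.
    What is left is the Taylor remainder. *)
Lemma incr_le_gap k : (K0 <= k)%N -> normc (incr k) <= eta * 2 ^- k.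
Proof.
move=> Kk; pose S x : R := \sum_(j < k) f ((b j)%:R * x).
(* For k > 0 this is the largest N with [k * N < b k]. By the gap hypothesis it is at least
   [D * b j] for every j < k. *)
pose N := ((b k).-1 %/ k)%N.
have tS : trigp N (fun x => (S x)%:C).
  rewrite /S; under eq_fun do rewrite rmorph_sum /=.
  apply: trigp_sum => j _; apply: (@trigp_mono _ (b j * D)%N).
    rewrite mulnC /N leq_divRL ?(leq_ltn_trans _ (ltn_ord j))//.
    by rewrite -ltnS prednK// mulnC b_gap.
  exact: trigp_dilate f_trig.
pose T x := \sum_(p < k) (l * (S x)%:C) ^+ p / p`!%:R.
pose Q x := g ((b k)%:R * x) - 1.
have tT : trigp (k * N) T.
  apply: trigp_sum => p _; under eq_fun do rewrite mulrC exprMn mulrA.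
  apply: trigpZ; apply: (@trigp_mono _ (p * N)); first by rewrite leq_mul2r ltnW ?orbT.
  exact: trigpX.
have Nk : (k * N < b k)%N.
  by rewrite -[ltnRHS](prednK (b_gt0 k)) ltnS mulnC leq_divM.
have cT : ccontinuous T := trigp_continuous tT.
have cQ : ccontinuous Q by exact: g_dil_cont.
have Q0 : cmean Q = 0.
  rewrite cmeanB ?cmean_cst; last 2 first.
  - exact/ccontinuous_dilate/tilted_continuous.
  - exact: ccontinuous_cst.
  rewrite cmean_dilate ?cmean_tilted ?subrr//; first exact: tilted_continuous.
  exact: tilted_periodic.
(* [Q] has period [1 / b k] and mean 0, and averaging over that period makes [T] constant. *)
have TQ0 : cmean (fun x => T x * Q x) = 0.
  rewrite (@cmean_shift_avg _ (b k))//.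
  - have [c cE] := trigp_shift_avg Nk tT.
    under eq_fun do rewrite cE.
    by rewrite cmeanZ// Q0 mulr0.
  - exact: trigp_periodic tT.
  - by move=> x; rewrite /Q; congr (_ - 1); exact: (shift_periodic_dilate (b_gt0 k) (@tilted_periodic l)).
have cE : ccontinuous (fun x => cexp (l * (S x)%:C)).
  apply: ccontinuous_cexp; apply: ccontinuousM; first exact: ccontinuous_cst.
  exact: trigp_continuous tS.
have -> : incr k = cmean (fun x => (cmgf l ^+ k)^-1 * ((cexp (l * (S x)%:C) - T x) * Q x)).
  have -> : cmean (fun x => (cmgf l ^+ k)^-1 * ((cexp (l * (S x)%:C) - T x) * Q x)) =
      cmean (fun x => (cmgf l ^+ k)^-1 * (cexp (l * (S x)%:C) * Q x)
        - (cmgf l ^+ k)^-1 * (T x * Q x)).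
    by congr cmean; apply/funext => x; ring.
  rewrite cmeanB; last 2 first.
  - by apply: ccontinuousM; [exact: ccontinuous_cst|exact: ccontinuousM].
  - by apply: ccontinuousM; [exact: ccontinuous_cst|exact: ccontinuousM].
  rewrite [X in _ = _ - X]cmeanZ; last exact: ccontinuousM.
  rewrite TQ0 mulr0 subr0 /incr; congr cmean; apply/funext => x.
  by rewrite /g prod_tilted -/(S x) mulrA [_^-1 * _]mulrC.
apply: normc_cmean_le => [|x].
  apply: ccontinuousM; first exact: ccontinuous_cst.
  by apply: ccontinuousM => //; exact: ccontinuousB.
rewrite !ComplexField.Normc.normcM mulrA mulrC ler_pM ?mulr_ge0 ?normc_ge0 ?tilted_sub1//.
have y_small := l_small; have y_ge0 := lM_ge0.
set y := normc l * M in y_small y_ge0.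
have lS : normc (l * (S x)%:C) <= y * k%:R.
  rewrite ComplexField.Normc.normcM normc_real -mulrA ler_wpM2l ?normc_ge0//.
  rewrite (le_trans (ler_norm_sum _ _ _))//.
  have -> : M * k%:R = \sum_(j < k) M by rewrite sumr_const card_ord mulr_natr.
  exact: ler_sum.
have yk0 : 0 <= y * k%:R by rewrite mulr_ge0.
have h1 : normc (cexp (l * (S x)%:C) - T x) <= (8 ^- k * expR (1 / 2) ^+ k) .
  rewrite (le_trans (cexp_taylor _ _))//.
  have -> : 8 ^- k * expR (1 / 2) ^+ k = 16 ^- k * 2 ^+ k * expR (1/2) ^+ k :> R.
    by rewrite -!exprVn -!exprMn; congr (_ ^+ _); field.
  (* Writing [2 * (y * k%:R)] as 1/16 of [32 * (y * k%:R)] buys the factor [16 ^- k], and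
     [pow_fact_le_expR] absorbs the factorial. As y <= 1/160, the two exponentials together are at
     most exp(33 k / 160). *)
  apply: (@le_trans _ _ (16 ^- k * expR (32 * (y * k%:R)) * expR (y * k%:R))).
    rewrite ler_pM ?divr_ge0 ?exprn_ge0 ?mulr_ge0 ?normc_ge0 ?expR_ge0 ?ler_expR//.
    apply: (@le_trans _ _ (16 ^- k * ((32 * (y * k%:R)) ^+ k / k`!%:R))).
      rewrite [leRHS]mulrA -exprVn -exprMn ler_pM2r ?invr_gt0 ?ltr0n ?fact_gt0//.
      rewrite lerXn2r ?nnegrE ?mulr_ge0 ?normc_ge0 ?(ltW M_gt0)//.
      have -> : 16^-1 * (32 * (y * k%:R)) = 2 * (y * k%:R) by field.
      by rewrite ler_wpM2l.
    by rewrite ler_wpM2l ?invr_ge0 ?exprn_ge0// pow_fact_le_expR// mulr_ge0.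
  rewrite -mulrA -[leRHS]mulrA ler_wpM2l ?invr_ge0 ?exprn_ge0// -expRD.
  have -> : 32 * (y * k%:R) + y * k%:R = k%:R * (33 * y) by ring.
  rewrite expRM_natl -exprMn lerXn2r ?nnegrE ?mulr_ge0 ?expR_ge0//.
  have : expR (33 * y) <= 1 * expR (1 / 2) by rewrite mul1r ler_expR; lra.
  have := expR_ge0 (1 / 2 : R); lra.
have h2 : normc (cmgf l ^+ k)^-1 <= 2 ^+ k.
  rewrite -exprVn normcX lerXn2r ?nnegrE ?normc_ge0//.
  exact: normc_cmgf_inv.
apply: le_trans (ler_pM (normc_ge0 _) (normc_ge0 _) h2 h1) _.
(* The base of the k-th power is 2 * (1/8) * exp(1/2), at most 1/2. *)
rewrite -!exprVn mulrA -!exprMn lerXn2r ?nnegrE ?mulr_ge0 ?expR_ge0 ?invr_ge0//.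
have : expR (1 / 2) <= 2 :> R by exact: expR_le2.
lra.
Qed.

(** For k below [K0] the crude bound satisfies [2 ^+ k <= 4 ^+ K0 * 2 ^- k], so one geometric series
    covers all k; its partial sum is [2 - 2 * 2 ^- n]. *)
Lemma dilated_prod_gap n :
  normc (cmean (dilated_prod (tilted l) b n) - 1) <= 16 * (normc l * M) * (2 * 4 ^+ K0).
Proof.
rewrite -/g -/eta.
suff : normc (cmean (dilated_prod g b n) - 1) <= eta * (4 ^+ K0 * (2 - 2 * 2 ^- n)).
  move=> /le_trans; apply; rewrite ler_wpM2l// mulrC ler_wpM2r ?exprn_ge0//.
  by rewrite gerBl mulr_ge0 ?invr_ge0 ?exprn_ge0.
elim: n => [|n ih].
  rewrite /dilated_prod; under eq_fun do rewrite big_ord0.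
  by rewrite cmean_cst subrr ComplexField.Normc.normc0 expr0 invr1 mulr1 subrr !mulr0.
rewrite (le_trans (normc_distD _ (cmean (dilated_prod g b n)) _))// dilated_prod_incr.
have h : normc (incr n) <= eta * (4 ^+ K0 * 2 ^- n).
  have [Kn|nK] := leqP K0 n.
    rewrite (le_trans (incr_le_gap Kn))// ler_wpM2l// ler_peMl ?invr_ge0 ?exprn_ge0//.
    by apply: exprn_ege1; rewrite ler1n.
  rewrite (le_trans (incr_le_crude n))// ler_wpM2l//.
  rewrite ler_pdivlMr ?exprn_gt0// -exprMn (_ : 2 * 2 = 4 :> R); last by lra.
  by apply: ler_weXn2l; [rewrite ler1n|exact: ltnW].
rewrite (le_trans (lerD h ih))// -mulrDr -mulrDr ler_wpM2l// ler_wpM2l ?exprn_ge0//.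
by rewrite exprS invfM; lra.
Qed.

End LargeGaps.
End SmallParameter.
End TiltedFactor.

(** * Cumulants *)

Section SmoothFunctions.
Variable R : realType.
Implicit Types (f g df dg : R -> R).

(** Differentiability n times on the whole line, with the derivatives as witnesses, so that closed
    forms can be supplied directly. *)
Fixpoint smooth n f : Prop :=
  if n is n'.+1 then
    exists2 df, forall x, is_derive x (1 : R) f (df x) & smooth n' df
  else True.

Lemma smooth_pred n f : smooth n.+1 f -> smooth n f.
Proof.
elim: n f => [|n ih] f // [df dfE sdf]; exists df => //.
exact: ih.
Qed.

Lemma smoothD n f g : smooth n f -> smooth n g -> smooth n (fun x => f x + g x).
Proof.
elim: n f g => [//|n ih] f g [df dfE sdf] [dg dgE sdg].
exists (fun x => df x + dg x); last exact: ih.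
by move=> x; exact: is_derive_addf.
Qed.

Lemma smoothM n f g : smooth n f -> smooth n g -> smooth n (fun x => f x * g x).
Proof.
elim: n f g => [//|n ih] f g sf sg.
have [df dfE sdf] := sf; have [dg dgE sdg] := sg.
exists (fun x => df x * g x + f x * dg x).
  by move=> x; exact: is_derive_mulf.
by apply: smoothD; apply: ih => //; exact: smooth_pred.
Qed.

Lemma smooth_cst n (c : R) : smooth n (fun=> c).
Proof.
elim: n c => // n ih c; exists (fun=> 0); last exact: ih.
by move=> x; exact: is_derive_cst.
Qed.

Lemma smoothV n f : (forall x, f x != 0) -> smooth n f -> smooth n (fun x => (f x)^-1).
Proof.
move=> f0; elim: n => [//|n ih] sf; have [df dfE sdf] := sf.
exists (fun x => -1 * (df x * ((f x)^-1 * (f x)^-1))).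
  move=> x; apply: (is_derive_eq (is_deriveV (f0 x) (dfE x))).
  by rewrite /GRing.scale /= -exprVn expr2; ring.
apply: smoothM; first exact: smooth_cst.
have sV := ih (smooth_pred sf).
by apply: smoothM => //; exact: smoothM.
Qed.

Lemma smooth_horner n (p : {poly R}) : smooth n (horner p).
Proof.
elim: n p => // n ih p; exists (horner p^`()); last exact: ih.
by move=> x; exact: is_derive_poly.
Qed.

Lemma is_derive_derive1 f df : (forall x, is_derive x (1 : R) f (df x)) -> derive1 f = df.
Proof. by move=> dfE; apply/funext => x; rewrite derive1E; have [] := dfE x. Qed.

Lemma derive1n_head m f : derive1n m.+1 f = derive1n m (derive1 f).
Proof. by rewrite /derive1n iterSr. Qed.

Lemma derive1n_horner m (p : {poly R}) :
  derive1n m (horner p) = horner p^`(m).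
Proof.
elim: m p => [//|m ih] p.
by rewrite derive1n_head (is_derive_derive1 (is_derive_poly p)) ih derivSn.
Qed.

Lemma derive1n_horner0 m (p : {poly R}) : derive1n m (horner p) 0 = p`_m * m`!%:R.
Proof.
by rewrite derive1n_horner horner_coef0 coef_derivn addn0 ffactnn mulr_natr.
Qed.

(** Taylor's theorem with an unspecified constant, by iterating the mean value theorem. One
    derivative beyond n is asked so that the n-th derivative of the difference is continuous, hence
    bounded near 0. *)
Lemma smooth_jet_close n f g : smooth n.+1 f -> smooth n.+1 g ->
  (forall m, (m < n)%N -> derive1n m f 0 = derive1n m g 0) ->
  exists2 d : R, 0 < d & exists2 C : R, 0 <= C &
    forall t : R, `|t| <= d -> `|f t - g t| <= C * `|t| ^+ n.
Proof.
elim: n f g => [|n ih] f g [df dfE sdf] [dg dgE sdg] jet.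
  have ch : continuous (fun x => f x - g x).
    exact: (is_derive_continuous (fun x => is_derive_subf (dfE x) (dgE x))).
  have /cvgrPdist_le /(_ 1 ltr01) := ch 0.
  move=> /nbhs_ballP[d /= d0 hd].
  exists (d / 2); first by rewrite divr_gt0.
  exists (1 + `|f 0 - g 0|); first by rewrite addr_ge0.
  move=> t td; rewrite expr0 mulr1.
  have /hd /= : ball (0 : R) d t.
    by rewrite /ball /= sub0r normrN (le_lt_trans td)// gtr_pMr// invf_lt1//; lra.
  rewrite distrC => h; rewrite -[f t - g t](subrK (f 0 - g 0)).
  by rewrite (le_trans (ler_normD _ _))// lerD2r.
have [|d d0 [C C0 hC]] := ih df dg sdf sdg.
  move=> m mn; have := jet m.+1 mn.
  by rewrite !derive1n_head (is_derive_derive1 dfE) (is_derive_derive1 dgE).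
exists d => //; exists C => // t td.
pose w x := f x - g x.
have dw x : is_derive x (1 : R) w (df x - dg x) by exact: is_derive_subf.
have cw : continuous w := is_derive_continuous dw.
have w0 : w 0 = 0 by rewrite /w; have := jet 0%N isT; rewrite /= => ->; rewrite subrr.
have key (a b c : R) : `|c| <= `|t| -> `|b - a| = `|t| ->
    w b - w a = (df c - dg c) * (b - a) -> `|w b - w a| <= C * `|t| ^+ n.+1.
  move=> ct bat ->; rewrite normrM bat exprSr mulrA ler_wpM2r//.
  rewrite (le_trans (hC c (le_trans ct td)))// ler_wpM2l// lerXn2r// ?nnegrE//.
have [t0|t0] := leP 0 t.
  have [|c] := @MVT_segment _ w (fun x => df x - dg x) 0 t t0 (fun x _ => dw x).
    exact: continuous_subspaceT.
  rewrite in_itv /= => /andP[c0 ct] E.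
  have h1 : `|c| <= `|t| by rewrite !ger0_norm.
  have h2 : `|t - 0| = `|t| by rewrite subr0.
  by have := key 0 t c h1 h2 E; rewrite w0 subr0.
have [|c] := @MVT_segment _ w (fun x => df x - dg x) t 0 (ltW t0) (fun x _ => dw x).
  exact: continuous_subspaceT.
rewrite in_itv /= => /andP[ct c0] E.
have h1 : `|c| <= `|t| by rewrite !ler0_norm ?(ltW t0)// lerN2.
have h2 : `|0 - t| = `|t| by rewrite sub0r normrN.
by have := key t 0 c h1 h2 E; rewrite w0 sub0r normrN.
Qed.

(** Allows differentiation under [mean] from a second-order estimate uniform in the integration
    variable, without a dominated convergence argument. *)
Lemma is_derive_quadratic f (t d C : R) :
  (forall h, `|h| <= 1 -> `|f (t + h) - f t - h * d| <= C * h ^+ 2) ->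
  is_derive t (1 : R) f d.
Proof.
move=> hC.
suff cv : (fun h => h^-1 *: (f (h *: (1 : R) + t) - f t)) @ 0^' --> d.
  by apply: DeriveDef; [apply/cvg_ex; exists d|exact: cvg_lim].
apply/cvgrPdist_le => e e0.
have eC : 0 < e / (`|C| + 1) by rewrite divr_gt0// ltr_wpDl.
near=> h.
have h0 : h != 0 by near: h; exact: nbhs_dnbhs_neq.
have h1 : `|h| <= 1.
  near: h; apply/nbhs_dnbhs; apply/nbhs_ballP; exists 1 => //= x.
  by rewrite /ball /= sub0r normrN => /ltW.
have he : `|h| <= e / (`|C| + 1).
  near: h; apply/nbhs_dnbhs; apply/nbhs_ballP; exists (e / (`|C| + 1)); first exact: eC.
  move=> x.
  by rewrite /ball /= sub0r normrN => /ltW.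
have -> : d - h^-1 *: (f (h *: (1 : R) + t) - f t) = - (h^-1 * (f (t + h) - f t - h * d)).
  by rewrite /GRing.scale /= mulr1 (addrC h t); field.
rewrite normrN normrM normfV ler_pdivrMl ?normr_gt0//.
rewrite (le_trans (hC h h1))// -[h ^+ 2]real_normK ?num_real// expr2 mulrCA.
rewrite ler_wpM2l// mulrC; have C1 : 0 < `|C| + 1 by rewrite ltr_wpDl.
move: he; rewrite ler_pdivlMr// => /(le_trans _); apply.
by rewrite ler_wpM2l// (le_trans (ler_norm C))// lerDl.
Unshelve. all: by end_near. Qed.

End SmoothFunctions.

(** * Polynomials near the origin *)

Section PolynomialGerms.
Variable R : realType.

Definition ceval (p : {poly R}) (z : R[i]) : R[i] := (map_poly (real_complex R) p).[z].

Lemma ceval_real (p : {poly R}) (t : R) : ceval p t%:C = (p.[t])%:C.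
Proof. by rewrite /ceval horner_map. Qed.

Lemma ceval_bound (p : {poly R}) :
  exists2 C : R, 0 <= C & forall z, normc z <= 1 -> normc (ceval p z) <= C.
Proof.
exists (\sum_(i < size p) `|p`_i|); first exact: sumr_ge0.
move=> z z1; rewrite /ceval (@horner_coef_wide _ (size p)) ?size_map_poly//.
rewrite (le_trans (normc_sum _ _))//; apply: ler_sum => i _.
rewrite coef_map ComplexField.Normc.normcM normc_real normcX ler_piMr//.
by rewrite exprn_ile1// normc_ge0.
Qed.

Lemma ceval_small (p : {poly R}) n : (forall i, (i < n)%N -> p`_i = 0) ->
  exists2 C : R, 0 <= C & forall z, normc z <= 1 -> normc (ceval p z) <= C * normc z ^+ n.
Proof.
move=> p0; have [C C0 hC] := ceval_bound (drop_poly n p); exists C => // z z1.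
have pE : p = drop_poly n p * 'X^n.
  rewrite -[LHS](poly_take_drop n p) (_ : take_poly n p = 0) ?add0r//.
  by apply/polyP => i; rewrite coef_take_poly coef0; case: ifP => // /p0.
rewrite pE /ceval rmorphM /= map_polyXn hornerM hornerXn ComplexField.Normc.normcM normcX.
by rewrite ler_wpM2r ?exprn_ge0 ?normc_ge0// hC.
Qed.

(** Letting t tend to 0 gives a zero constant term; then p is divided by 'X. The bound is asked for
    nonzero t, where the division by |t| preserves it. *)
Lemma horner_small_coef0 (p : {poly R}) n (d C : R) : 0 < d ->
  (forall t : R, t != 0 -> `|t| <= d -> `|p.[t]| <= C * `|t| ^+ n) ->
  forall i, (i < n)%N -> p`_i = 0.
Proof.
move=> d0; elim: n p => // n ih p hp.
have p00 : p`_0 = 0.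
  have [|B B0 hB] := @ceval_small (p - (p`_0)%:P) 1.
    by case=> //= _; rewrite coefB coefC eqxx subrr.
  have key (t : R) : 0 < t -> t <= d -> t <= 1 -> `|p`_0| <= (`|C| + B) * t.
    move=> t0 td t1; have tt : `|t| = t by rewrite gtr0_norm.
    have h1 := hp t; rewrite tt (gt_eqF t0) /= in h1; have {}h1 := h1 isT td.
    have := hB t%:C; rewrite normc_real tt => /(_ t1).
    rewrite ceval_real normc_real hornerD hornerN hornerC expr1 => h2.
    have h3 : C * t ^+ n.+1 <= `|C| * t.
      apply: (@le_trans _ _ (`|C| * t ^+ n.+1)).
        by rewrite ler_wpM2r ?exprn_ge0 ?(ltW t0)// ler_norm.
      by rewrite ler_wpM2l// exprS ler_piMr ?(ltW t0)// exprn_ile1 ?(ltW t0).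
    have := ler_normD p.[t] (- (p.[t] - p`_0)).
    rewrite opprB addrCA subrr addr0 distrC; move: h1 h2 h3; lra.
  apply/eqP; rewrite -normr_le0; apply/ler_addgt0Pr => e e0; rewrite add0r.
  have CB : 0 < `|C| + B + 1 by rewrite ltr_wpDl// addr_ge0.
  pose t := Num.min (Num.min d 1) (e / (`|C| + B + 1)).
  have t0 : 0 < t by rewrite !lt_min d0 ltr01 divr_gt0.
  have td : t <= d by rewrite /t !ge_min lexx.
  have t1 : t <= 1 by rewrite /t !ge_min lexx orbT.
  rewrite (le_trans (key t t0 td t1))//.
  have : t <= e / (`|C| + B + 1) by rewrite /t ge_min lexx orbT.
  by rewrite ler_pdivlMr// => h; rewrite mulrC; move: h t0; lra.
have pE : p = drop_poly 1 p * 'X.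
  rewrite -[LHS](poly_take_drop 1 p) expr1 (_ : take_poly 1 p = 0) ?add0r//.
  by apply/polyP => i; rewrite coef_take_poly coef0; case: ifP => //; case: i.
move=> [//|i] iN; rewrite -[i.+1]addn1 -coef_drop_poly.
apply: (ih (drop_poly 1 p)) => // t t0 td.
have := hp t t0 td; rewrite {1}pE hornerM hornerX normrM exprSr mulrA.
by rewrite ler_pM2r// normr_gt0.
Qed.

End PolynomialGerms.

(** * Expansion of the moment generating function of f *)

Section CumulantExpansion.
Variables (R : realType) (D : nat) (f : R -> R) (M : R).
Hypothesis f_trig : trigp D (fun x => (f x)%:C).
Hypothesis M_gt0 : 0 < M.
Hypothesis f_bound : forall x, `|f x| <= M.

Lemma f_continuous : continuous f.
Proof. by have [] := trigp_continuous f_trig. Qed.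

Definition exp_moment m (t : R) : R := mean (fun x => f x ^+ m * expR (t * f x)).

Lemma f_pow_continuous m : continuous (fun x => f x ^+ m).
Proof.
elim: m => [|m ih] x; first exact: cst_continuous.
by under eq_fun do rewrite exprS; apply: cvgM; [exact: f_continuous|exact: ih].
Qed.

Lemma expR_f_continuous (t : R) : continuous (fun x => expR (t * f x)).
Proof.
move=> x; have ct : {for x, continuous (fun y => t * f y)}.
  by apply: cvgM; [exact: cvg_cst|exact: f_continuous].
exact: (continuous_comp ct (@continuous_expR R _)).
Qed.

Lemma exp_moment_integrand_continuous m (t : R) :
  continuous (fun x => f x ^+ m * expR (t * f x)).
Proof. by move=> x; apply: cvgM; [exact: f_pow_continuous|exact: expR_f_continuous]. Qed.

Lemma expR_taylor2 (h : R) : `|h| <= M -> `|expR h - 1 - h| <= 2 * expR M * h ^+ 2.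
Proof.
move=> hM; have := cexp_taylor h%:C 2.
have -> : \sum_(p < 2) h%:C ^+ p / p`!%:R = 1 + h%:C.
  by rewrite !big_ord_recl big_ord0 addr0 expr0 expr1 !divr1.
rewrite cexp_real.
have -> : (expR h)%:C - (1 + h%:C) = (expR h - 1 - h)%:C.
  by rewrite opprD addrA !rmorphB rmorph1.
rewrite !normc_real => /le_trans; apply.
rewrite exprMn real_normK ?num_real//.
have -> : 2 ^+ 2 * h ^+ 2 / 2`!%:R * expR `|h| = 2 * h ^+ 2 * expR `|h|.
  by rewrite (_ : 2`! = 2)//; field.
by rewrite -mulrA -[leRHS]mulrA ler_wpM2l// [leRHS]mulrC ler_wpM2l ?sqr_ge0// ler_expR.
Qed.

(** The error of the linear approximation is the mean of [f ^+ m * expR (t * f)] times the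
    second-order remainder of [expR (h * f)], uniformly of order [h ^+ 2] because f is bounded. *)
Lemma is_derive_exp_moment m (t : R) :
  is_derive t (1 : R) (exp_moment m) (exp_moment m.+1 t).
Proof.
have c0 := exp_moment_integrand_continuous.
pose C := M ^+ m * expR (`|t| * M) * (2 * expR M * M ^+ 2).
apply: (@is_derive_quadratic _ _ t _ C) => h h1.
have -> : exp_moment m (t + h) - exp_moment m t - h * exp_moment m.+1 t =
    mean (fun x => f x ^+ m * expR ((t + h) * f x) +
     (-1 * (f x ^+ m * expR (t * f x)) + (- h) * (f x ^+ m.+1 * expR (t * f x)))).
  have cZ (a : R) (u : R -> R) : continuous u -> continuous (fun x => a * u x).
    by move=> cu x; apply: cvgM; [exact: cvg_cst|exact: cu].
  rewrite meanD//; last first.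
    by move=> x; apply: cvgD; apply: cvgM; [exact: cvg_cst|exact: c0|exact: cvg_cst|exact: c0].
  rewrite meanD; [|exact: cZ|exact: cZ].
  by rewrite !meanZ// mulN1r mulNr addrA.
have -> : (fun x => f x ^+ m * expR ((t + h) * f x) +
     (-1 * (f x ^+ m * expR (t * f x)) + (- h) * (f x ^+ m.+1 * expR (t * f x)))) =
   (fun x => f x ^+ m * expR (t * f x) * (expR (h * f x) - 1 - h * f x)).
  by apply/funext => x; rewrite mulrDl expRD exprSr; ring.
rewrite -normc_real -cmean_real.
apply: normc_cmean_le => [|x].
  apply: ccontinuous_real => x.
  apply: cvgM; first exact: c0.
  apply: cvgB; last by apply: cvgM; [exact: cvg_cst|exact: f_continuous].
  by apply: cvgB; [exact: expR_f_continuous|exact: cvg_cst].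
rewrite normc_real !normrM.
have hf : `|h * f x| <= M.
  by rewrite normrM -[leRHS]mul1r ler_pM.
have -> : C * h ^+ 2 = M ^+ m * expR (`|t| * M) * (2 * expR M * (M ^+ 2 * h ^+ 2)).
  by rewrite /C; ring.
rewrite ler_pM ?mulr_ge0//.
  rewrite ler_pM//; first by rewrite normrX lerXn2r ?nnegrE// ltW.
  rewrite ger0_norm ?expR_ge0// ler_expR (le_trans (ler_norm _))// normrM.
  by rewrite ler_wpM2l.
rewrite (le_trans (expR_taylor2 hf))// ler_wpM2l ?mulr_ge0 ?expR_ge0//.
rewrite exprMn mulrC ler_wpM2r ?sqr_ge0//.
by rewrite -[f x ^+ 2]real_normK ?num_real// lerXn2r ?nnegrE// ltW.
Qed.

Lemma exp_moment_smooth n m : smooth n (exp_moment m).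
Proof.
elim: n m => // n ih m; exists (exp_moment m.+1); last exact: ih.
by move=> t; exact: is_derive_exp_moment.
Qed.

Lemma exp_moment0_gt0 t : 0 < exp_moment 0 t.
Proof.
apply: (@lt_le_trans _ _ (mean (fun=> expR (- (`|t| * M))))).
  by rewrite mean_cst expR_gt0.
apply: le_mean; first by move=> x; exact: cst_continuous.
  exact: exp_moment_integrand_continuous.
move=> x; rewrite expr0 mul1r ler_expR lerNl (le_trans (ler_norm _))// normrN normrM.
by rewrite ler_wpM2l.
Qed.

Definition log_mgf (t : R) : R := ln (exp_moment 0 t).

Lemma is_derive_log_mgf t : is_derive t (1 : R) log_mgf (exp_moment 1 t / exp_moment 0 t).
Proof.
have := is_derive_compf (is_derive1_ln (exp_moment0_gt0 t)) (is_derive_exp_moment 0 t).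
by rewrite mulrC.
Qed.

Lemma log_mgf_smooth n : smooth n log_mgf.
Proof.
case: n => // n; exists (fun t => exp_moment 1 t / exp_moment 0 t).
  exact: is_derive_log_mgf.
apply: smoothM; first exact: exp_moment_smooth.
apply: smoothV; last exact: exp_moment_smooth.
by move=> x; rewrite gt_eqF// exp_moment0_gt0.
Qed.

Lemma exp_moment_at0 m : exp_moment m 0 = mean (fun x => f x ^+ m).
Proof.
by rewrite /exp_moment; congr mean; apply/funext => x; rewrite mul0r expR0 mulr1.
Qed.

Lemma exp_moment00 : exp_moment 0 0 = 1.
Proof.
by rewrite exp_moment_at0; under eq_fun do rewrite expr0; rewrite mean_cst.
Qed.

Hypothesis f_mean0 : mean f = 0.

Lemma exp_moment10 : exp_moment 1 0 = 0.
Proof. by rewrite exp_moment_at0. Qed.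

Lemma log_mgf0 : log_mgf 0 = 0.
Proof. by rewrite /log_mgf exp_moment00 ln1. Qed.

Lemma log_mgf_derive1 : derive1n 1 log_mgf 0 = 0.
Proof.
by rewrite derive1n1 (is_derive_derive1 is_derive_log_mgf) exp_moment10 mul0r.
Qed.

Lemma log_mgf_derive2 : derive1n 2 log_mgf 0 = mean (fun x => f x ^+ 2).
Proof.
rewrite derive1n_head (is_derive_derive1 is_derive_log_mgf) derive1n1.
have dV : is_derive (0 : R) (1 : R) (fun t => (exp_moment 0 t)^-1) 0.
  have n0 : exp_moment 0 0 != 0 by rewrite exp_moment00 oner_eq0.
  apply: (is_derive_eq (is_deriveV n0 (is_derive_exp_moment 0 0))).
  by rewrite exp_moment10 scaler0.
have := is_derive_mulf (is_derive_exp_moment 1 0) dV.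
rewrite mulr0 addr0 exp_moment00 invr1 mulr1 exp_moment_at0 => dd.
by rewrite derive1E; have [_ ->] := dd.
Qed.

Variables (rho : nat) (gam : R).
Hypothesis rho_ge3 : (3 <= rho)%N.
Hypothesis cumulants_vanish : forall m, (3 <= m < rho)%N -> derive1n m log_mgf 0 = 0.
Hypothesis cumulant_gam : derive1n rho log_mgf 0 = gam.

Definition log_mgf_poly : {poly R} :=
  (mean (fun x => f x ^+ 2) / 2) *: 'X^2 + (gam / rho`!%:R) *: 'X^rho.

(** The cumulants of order 1 and 2 are the mean, 0, and the second moment. With the hypotheses on
    the higher ones, both functions have the same derivatives at 0 up to order rho. *)
Lemma log_mgf_poly_close : exists2 d : R, 0 < d & exists2 C : R, 0 <= C &
  forall t : R, `|t| <= d -> `|log_mgf t - log_mgf_poly.[t]| <= C * `|t| ^+ rho.+1.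
Proof.
apply: smooth_jet_close; [exact: log_mgf_smooth|exact: smooth_horner|].
move=> m; rewrite ltnS => mr; rewrite derive1n_horner0 coefD !coefZ !coefXn.
have r2 : (2%N == rho) = false by rewrite ltn_eqF.
have r1 : (1%N == rho) = false by rewrite ltn_eqF// ltnW.
have r0 : (0%N == rho) = false by rewrite ltn_eqF// (leq_trans _ rho_ge3).
have [->|m0] := eqVneq m 0%N.
  by rewrite [LHS]log_mgf0 r0 /= !mulr0 addr0 mul0r.
have [->|m1] := eqVneq m 1%N.
  by rewrite log_mgf_derive1 r1 /= !mulr0 addr0 mul0r.
have [->|m2] := eqVneq m 2%N.
  by rewrite log_mgf_derive2 r2 /= mulr0 addr0 mulr1 divfK.
have m3 : (3 <= m)%N by case: m m0 m1 m2 {mr} => [|[|[|]]].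
rewrite /= mulr0 add0r; move: mr; rewrite leq_eqVlt => /predU1P[->|mr].
  by rewrite cumulant_gam eqxx mulr1 divfK// pnatr_eq0 -lt0n fact_gt0.
by rewrite cumulants_vanish ?m3// ltn_eqF// mulr0 mul0r.
Qed.

Lemma cmgf_real (t : R) : cmgf f t%:C = (exp_moment 0 t)%:C.
Proof.
rewrite -cmean_real; congr cmean; apply/funext => x.
by rewrite expr0 mul1r -rmorphM cexp_real.
Qed.

Definition mgf_poly : {poly R} :=
  \poly_(m < rho.+1) (mean (fun x => f x ^+ m) / m`!%:R).

Lemma cmgf_taylor : exists2 C : R, 0 <= C &
  forall l, normc l <= 1 -> normc (cmgf f l - ceval mgf_poly l) <= C * normc l ^+ rho.+1.
Proof.
exists ((2 * M) ^+ rho.+1 / rho.+1`!%:R * expR M).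
  by rewrite !mulr_ge0 ?exprn_ge0 ?mulr_ge0 ?invr_ge0 ?expR_ge0 ?ltW.
move=> l l1.
have fC p : ccontinuous (fun x => (f x ^+ p)%:C).
  exact/ccontinuous_real/f_pow_continuous.
have tE : ceval mgf_poly l =
    cmean (fun x => \sum_(p < rho.+1) (l * (f x)%:C) ^+ p / p`!%:R).
  have -> : (fun x => \sum_(p < rho.+1) (l * (f x)%:C) ^+ p / p`!%:R) =
      (fun x => \sum_(p < rho.+1) (l ^+ p / p`!%:R) * (f x ^+ p)%:C).
    by apply/funext => x; apply: eq_bigr => p _; rewrite exprMn rmorphXn mulrAC.
  rewrite cmean_sum; last first.
    by move=> p; apply: ccontinuousM; [exact: ccontinuous_cst|exact: fC].
  rewrite /ceval (@horner_coef_wide _ rho.+1) ?size_map_poly ?size_poly//.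
  apply: eq_bigr => p _; rewrite cmeanZ ?cmean_real; last exact: fC.
  rewrite coef_map /= coef_poly ltn_ord rmorphM fmorphV rmorph_nat; ring.
have cs : ccontinuous (fun x => \sum_(p < rho.+1) (l * (f x)%:C) ^+ p / p`!%:R).
  apply: ccontinuous_sum => p; apply: ccontinuousM; last exact: ccontinuous_cst.
  apply: ccontinuousX; apply: ccontinuousM; first exact: ccontinuous_cst.
  exact/ccontinuous_real/f_continuous.
have ce := cexp_f_continuous f_trig l.
rewrite tE -cmeanB//; apply: normc_cmean_le => [|x]; first exact: ccontinuousB.
rewrite (le_trans (cexp_taylor _ _))//.
have -> : (2 * M) ^+ rho.+1 / rho.+1`!%:R * expR M * normc l ^+ rho.+1 =
  (2 * (normc l * M)) ^+ rho.+1 / rho.+1`!%:R * expR M by rewrite !exprMn; ring.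
have lf := normc_lf f_bound l x.
rewrite ler_pM ?divr_ge0 ?exprn_ge0 ?mulr_ge0 ?normc_ge0 ?expR_ge0 ?ler_expR//.
  rewrite ler_wpM2r ?invr_ge0// lerXn2r ?nnegrE ?mulr_ge0 ?normc_ge0 ?(ltW M_gt0)//.
  by rewrite ler_wpM2l.
by rewrite (le_trans lf)// ler_piMl// ltW.
Qed.

(** The exponential series cut at order rho, to have a polynomial whose coefficients can be
    compared. The cut costs only order rho + 1, because [log_mgf_poly] vanishes at 0. *)
Definition exp_log_mgf_poly : {poly R} :=
  \sum_(j < rho.+1) (j`!%:R^-1) *: log_mgf_poly ^+ j.

Lemma ceval_log_mgf_poly (l : R[i]) : ceval log_mgf_poly l =
  l ^+ 2 * (mean (fun x => f x ^+ 2) / 2)%:C + l ^+ rho * (gam / rho`!%:R)%:C.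
Proof.
by rewrite /ceval rmorphD /= !map_polyZ /= !map_polyXn hornerD !hornerZ !hornerXn
  mulrC [X in _ + X]mulrC.
Qed.

Lemma ceval_exp_log_mgf_poly (l : R[i]) : ceval exp_log_mgf_poly l =
  \sum_(j < rho.+1) ceval log_mgf_poly l ^+ j / j`!%:R.
Proof.
rewrite /ceval rmorph_sum horner_sum; apply: eq_bigr => j _.
by rewrite /= map_polyZ hornerZ rmorphXn horner_exp fmorphV rmorph_nat mulrC.
Qed.

Lemma ceval_log_mgf_poly_le : exists2 C : R, 0 <= C &
  forall l, normc l <= 1 -> normc (ceval log_mgf_poly l) <= C * normc l.
Proof.
have [|C C0 hC] := @ceval_small _ log_mgf_poly 1; last first.
  by exists C => // l /hC; rewrite expr1.
move=> [|//] _; rewrite coefD !coefZ !coefXn (@ltn_eqF 0 rho) ?(leq_trans _ rho_ge3)//=.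
by rewrite !mulr0 addr0.
Qed.

Lemma cexp_log_mgf_poly_taylor : exists2 C : R, 0 <= C & forall l, normc l <= 1 ->
  normc (cexp (ceval log_mgf_poly l) - ceval exp_log_mgf_poly l) <= C * normc l ^+ rho.+1.
Proof.
have [C C0 hC] := ceval_log_mgf_poly_le.
exists ((2 * C) ^+ rho.+1 / rho.+1`!%:R * expR C).
  by rewrite !mulr_ge0 ?exprn_ge0 ?mulr_ge0 ?invr_ge0 ?expR_ge0.
move=> l l1; have {}hC := hC l l1.
rewrite ceval_exp_log_mgf_poly (le_trans (cexp_taylor _ _))//.
have -> : (2 * C) ^+ rho.+1 / rho.+1`!%:R * expR C * normc l ^+ rho.+1 =
  (2 * (C * normc l)) ^+ rho.+1 / rho.+1`!%:R * expR C by rewrite !exprMn; ring.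
rewrite ler_pM ?divr_ge0 ?exprn_ge0 ?mulr_ge0 ?normc_ge0 ?expR_ge0 ?ler_expR//.
  rewrite ler_wpM2r ?invr_ge0// lerXn2r ?nnegrE ?mulr_ge0 ?normc_ge0//.
  by rewrite ler_wpM2l.
by rewrite (le_trans hC)// ler_piMr.
Qed.

(** For real t both polynomials approximate [exp_moment 0 t], which is [expR (log_mgf t)], up to
    order rho + 1; hence so small is their difference, and its low coefficients vanish. *)
Lemma mgf_poly_coef i : (i < rho.+1)%N -> (mgf_poly - exp_log_mgf_poly)`_i = 0.
Proof.
have [d d0 [C C0 hC]] := log_mgf_poly_close.
have [C1 C10 hC1] := cmgf_taylor.
have [C2 C20 hC2] := cexp_log_mgf_poly_taylor.
have [C3 C30 hC3] := ceval_log_mgf_poly_le.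
pose C4 := expR C3 * (2 * C * expR C).
pose d1 := Num.min d 1.
have d10 : 0 < d1 by rewrite lt_min d0 ltr01.
apply: (@horner_small_coef0 _ _ _ d1 (C1 + C2 + C4)) => // t t0.
rewrite le_min => /andP[td t1].
have tc : normc t%:C <= 1 by rewrite normc_real.
have h1 := hC1 _ tc; have h2 := hC2 _ tc; have h3 := hC3 _ tc; have h := hC _ td.
rewrite cmgf_real !ceval_real -?rmorphB ?cexp_real -?rmorphB !normc_real in h1 h2 h3.
rewrite hornerD hornerN.
have -> : mgf_poly.[t] - exp_log_mgf_poly.[t] =
   - (exp_moment 0 t - mgf_poly.[t]) + (expR log_mgf_poly.[t] - exp_log_mgf_poly.[t])
   + (exp_moment 0 t - expR log_mgf_poly.[t]) by ring.
have tn1 : `|t| ^+ rho.+1 <= 1 by rewrite exprn_ile1.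
have h4 : `|exp_moment 0 t - expR log_mgf_poly.[t]| <= C4 * `|t| ^+ rho.+1.
  have -> : exp_moment 0 t = expR (log_mgf t) by rewrite lnK// posrE exp_moment0_gt0.
  have -> : expR (log_mgf t) - expR log_mgf_poly.[t] =
      expR log_mgf_poly.[t] * (expR (log_mgf t - log_mgf_poly.[t]) - 1).
    by rewrite mulrBr mulr1 -expRD addrCA subrr addr0.
  rewrite normrM /C4 -mulrA ler_pM//.
    rewrite ger0_norm ?expR_ge0// ler_expR (le_trans (ler_norm _))// (le_trans h3)//.
    by rewrite ler_piMr.
  have := cexp_sub1 (log_mgf t - log_mgf_poly.[t])%:C.
  rewrite cexp_real -(rmorph1 (real_complex R)) -rmorphB !normc_real => /le_trans; apply.
  have -> : 2 * C * expR C * `|t| ^+ rho.+1 = 2 * (C * `|t| ^+ rho.+1) * expR C by ring.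
  rewrite ler_pM ?mulr_ge0 ?expR_ge0 ?ler_expR ?ler_wpM2l//.
  by rewrite (le_trans h)// ler_piMr.
rewrite (le_trans (ler_normD _ _))// (le_trans (lerD (ler_normD _ _) (lexx _)))// normrN.
by move: h1 h2 h4; lra.
Qed.

(* The equality of Taylor coefficients was read off on the real line; as an
   identity between polynomials it carries over to complex arguments. *)
Lemma cmgf_ratio : exists2 C : R, 0 <= C & forall l, normc l <= 1 ->
  normc (cexp (- ceval log_mgf_poly l) * cmgf f l - 1) <= C * normc l ^+ rho.+1.
Proof.
have [C1 C10 hC1] := cmgf_taylor.
have [C2 C20 hC2] := cexp_log_mgf_poly_taylor.
have [C3 C30 hC3] := ceval_log_mgf_poly_le.
have [C4 C40 hC4] := ceval_small mgf_poly_coef.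
exists (expR C3 * (C1 + C2 + C4)).
  by rewrite mulr_ge0 ?expR_ge0 ?addr_ge0.
move=> l l1.
have -> : cexp (- ceval log_mgf_poly l) * cmgf f l - 1 =
    cexp (- ceval log_mgf_poly l) * (cmgf f l - cexp (ceval log_mgf_poly l)).
  by rewrite mulrBr cexpN.
rewrite ComplexField.Normc.normcM -mulrA ler_pM ?normc_ge0//.
  rewrite (le_trans (normc_cexp_le _))// ler_expR normcN (le_trans (hC3 l l1))//.
  by rewrite ler_piMr.
rewrite (le_trans (normc_distD _ (ceval mgf_poly l) _))//.
have h1 := hC1 l l1; have h2 := hC2 l l1; have h4 := hC4 l l1.
have h5 := normc_distD (ceval mgf_poly l) (ceval exp_log_mgf_poly l)
  (cexp (ceval log_mgf_poly l)).
rewrite (normcB (ceval exp_log_mgf_poly l)) in h5.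
move: h4; rewrite /ceval rmorphB hornerD hornerN => h4.
move: h1 h2 h4 h5; rewrite /ceval; lra.
Qed.

End CumulantExpansion.

(** * Variance *)

Section Variance.
Variables (R : realType) (D : nat) (f : R -> R) (M : R).
Hypothesis f_trig : trigp D (fun x => (f x)%:C).
Hypothesis M_gt0 : 0 < M.
Hypothesis f_bound : forall x, `|f x| <= M.
Hypothesis f_lip : forall x y, `|f x - f y| <= M * `|x - y|.
Hypothesis f_mean0 : mean f = 0.
Variable b : nat -> nat.
Hypothesis b_gt0 : forall k, (0 < b k)%N.

Definition dilated_sum k x : R := \sum_(j < k) f ((b j)%:R * x).

Definition freq_ratio_sum n : R := \sum_(k < n) ((prev_freq b k)%:R / (b k)%:R).

Let f_cont : continuous f := f_continuous f_trig.
Let f_per : periodic1 f := f_periodic f_trig.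

Lemma dilate_f_continuous (a : R) : continuous (fun x => f (a * x)).
Proof.
by have [] := ccontinuous_dilate a (trigp_continuous f_trig).
Qed.

Lemma dilated_sum_continuous k : continuous (dilated_sum k).
Proof.
elim: k => [|k ih] x; rewrite /dilated_sum.
  by under eq_fun do rewrite big_ord0; exact: cst_continuous.
under eq_fun do rewrite big_ord_recr /=.
by apply: cvgD; [exact: ih|exact: dilate_f_continuous].
Qed.

Lemma dilated_sum_periodic k : periodic1 (dilated_sum k).
Proof.
move=> x; apply: eq_bigr => j _.
by rewrite mulrDr mulr1 (periodic1_nat _ _ f_per).
Qed.

Lemma dilated_sum_lipschitz k :
  clipschitz (M * \sum_(j < k) (b j)%:R) (fun x => (dilated_sum k x)%:C).
Proof.
move=> x y; rewrite -rmorphB normc_real -sumrB (le_trans (ler_norm_sum _ _ _))//.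
rewrite mulr_sumr mulr_suml; apply: ler_sum => j _.
by rewrite (le_trans (f_lip _ _))// -mulrBr normrM ger0_norm// mulrA.
Qed.

(** The last term has period [1 / b k] and mean 0. The partial sum may therefore be averaged over
    that period and a constant subtracted, which leaves only an oscillation of its Lipschitz
    constant over [b k]. *)
Lemma covariance_le k :
  `|mean (fun x => dilated_sum k x * f ((b k)%:R * x))|
    <= M * (\sum_(j < k) (b j)%:R) / (b k)%:R * M.
Proof.
rewrite -normc_real -cmean_real.
pose F x := (dilated_sum k x)%:C; pose G x := (f ((b k)%:R * x))%:C.
have cF : ccontinuous F by exact/ccontinuous_real/dilated_sum_continuous.
have cG : ccontinuous G by exact/ccontinuous_real/dilate_f_continuous.
have pF : periodic1 F by move=> x; rewrite /F dilated_sum_periodic.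
have pG : shift_periodic (b k) G.
  exact: (shift_periodic_dilate (b_gt0 k) (trigp_periodic f_trig)).
have G0 : cmean G = 0 by rewrite cmean_real mean_dilate ?f_mean0.
have cA := shift_avg_continuous (b k) cF.
have -> : cmean (fun x => (dilated_sum k x * f ((b k)%:R * x))%:C) =
    cmean (fun x => (shift_avg (b k) F x - shift_avg (b k) F 0) * G x).
  under eq_fun do rewrite rmorphM /=.
  rewrite (@cmean_shift_avg _ (b k) F G)//.
  have -> : (fun x => (shift_avg (b k) F x - shift_avg (b k) F 0) * G x) =
      (fun x => shift_avg (b k) F x * G x - shift_avg (b k) F 0 * G x).
    by apply/funext => x; rewrite mulrBl.
  rewrite cmeanB; last 2 first.
  - exact: ccontinuousM.
  - by apply: ccontinuousM => //; exact: ccontinuous_cst.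
  by rewrite [X in _ - X]cmeanZ// G0 mulr0 subr0.
apply: normc_cmean_le => [|x].
  by apply: ccontinuousM => //; exact: ccontinuousB (ccontinuous_cst _).
rewrite ComplexField.Normc.normcM ler_pM ?normc_ge0//; last by rewrite normc_real.
apply: shift_periodic_osc => //; first exact/shift_avg_lipschitz/dilated_sum_lipschitz.
exact: shift_avg_periodic.
Qed.

Variable q : R.
Hypothesis q_gt1 : 1 < q.
Hypothesis b_lac : forall k, q * (b k)%:R <= (b k.+1)%:R.

(** By lacunarity the sum is dominated by its last term, with the geometric series constant of ratio
    1/q. *)
Lemma sum_freq_le k :
  \sum_(j < k) (b j)%:R <= q / (q - 1) * (prev_freq b k)%:R :> R.
Proof.
have q1 : 0 < q - 1 by rewrite subr_gt0.
have q0 : 0 < q by rewrite (lt_trans _ q_gt1).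
elim: k => [|[|k] ih]; first by rewrite big_ord0 mulr0.
  rewrite big_ord_recr big_ord0 /= add0r ler_peMl//.
  by rewrite ler_pdivlMr// mul1r gerBl.
rewrite big_ord_recr /= (le_trans (lerD ih (lexx _)))//=.
have -> : q / (q - 1) * (b k.+1)%:R = (b k.+1)%:R / (q - 1) + (b k.+1)%:R.
  by field; rewrite gt_eqF.
by rewrite lerD2r mulrAC ler_pM2r ?invr_gt0.
Qed.

(** Expanding the square, each new term adds the second moment of f and twice a covariance. *)
Lemma variance_close n :
  `|mean (fun x => dilated_sum n x ^+ 2) - n%:R * mean (fun x => f x ^+ 2)|
    <= 2 * M ^+ 2 * (q / (q - 1)) * freq_ratio_sum n.
Proof.
have cS := dilated_sum_continuous.
have cM (u v : R -> R) : continuous u -> continuous v -> continuous (fun x => u x * v x).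
  by move=> cu cv x; apply: cvgM; [exact: cu|exact: cv].
have cZ (a : R) (u : R -> R) : continuous u -> continuous (fun x => a * u x).
  by move=> cu x; apply: cvgM; [exact: cvg_cst|exact: cu].
have c2 (u : R -> R) : continuous u -> continuous (fun x => u x ^+ 2).
  by move=> cu; under eq_fun do rewrite expr2; exact: cM.
elim: n => [|n ih].
  rewrite /dilated_sum; under eq_fun do rewrite big_ord0 expr0n /=.
  by rewrite mean_cst mul0r subrr normr0 /freq_ratio_sum big_ord0 mulr0.
pose u := fun x => f ((b n)%:R * x).
have cu : continuous u by move=> x; exact: dilate_f_continuous.
have -> : mean (fun x => dilated_sum n.+1 x ^+ 2) =
    mean (fun x => dilated_sum n x ^+ 2) + (2 * mean (fun x => dilated_sum n x * u x)
      + mean (fun x => f x ^+ 2)).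
  have -> : mean (fun x => f x ^+ 2) = mean (fun x => u x ^+ 2).
    rewrite -[LHS](@mean_dilate _ _ (b n))//; first exact: c2.
    by move=> x; rewrite f_per.
  have cSu := cM _ _ (cS n) cu.
  rewrite -meanZ// -meanD; [|exact: cZ|exact: c2].
  rewrite -meanD; [|exact: c2|]; last first.
    by move=> x; apply: cvgD; [exact: (cZ 2 _ cSu)|exact: (c2 _ cu)].
  congr mean; apply/funext => x.
  by rewrite /dilated_sum big_ord_recr /= /u; ring.
rewrite -[n.+1%:R]natr1 /freq_ratio_sum big_ord_recr /=.
have h := covariance_le n.
have h2 : M * (\sum_(j < n) (b j)%:R) / (b n)%:R * M <=
    M ^+ 2 * (q / (q - 1)) * ((prev_freq b n)%:R / (b n)%:R).
  have -> : M * (\sum_(j < n) (b j)%:R) / (b n)%:R * M =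
    M ^+ 2 * ((\sum_(j < n) (b j)%:R) / (b n)%:R) by ring.
  rewrite -mulrA ler_wpM2l ?sqr_ge0// mulrA ler_pM2r ?invr_gt0 ?ltr0n//.
  exact: sum_freq_le.
rewrite -/(freq_ratio_sum n).
set V := mean (fun x => dilated_sum n x ^+ 2) in ih *.
set W := mean (fun x => dilated_sum n x * _) in h *.
set s2 := mean (fun x => f x ^+ 2) in ih *.
have -> : V + (2 * W + s2) - (n%:R + 1) * s2 = (V - n%:R * s2) + 2 * W by ring.
rewrite (le_trans (ler_normD _ _))// mulrDr lerD// normrM ger0_norm//.
have := le_trans h h2; lra.
Qed.

End Variance.

(** * Growth conditions *)

Section Normalization.
Variables (R : realType) (rho : nat).
Hypothesis rho_ge3 : (3 <= rho)%N.

Definition kappa (n : nat) : R := n%:R `^ (rho%:R^-1).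

Let rho0 : (rho%:R : R) != 0.
Proof. by rewrite pnatr_eq0 -lt0n (leq_trans _ rho_ge3). Qed.

Lemma kappa_gt0 n : (0 < n)%N -> 0 < kappa n.
Proof. by move=> n0; rewrite powR_gt0// ltr0n. Qed.

Lemma kappaX_rho n : kappa n ^+ rho = n%:R.
Proof. by rewrite -powR_mulrn ?powR_ge0// -powRrM mulVf// powRr1. Qed.

Lemma kappa_sqr n : n%:R `^ (2 / rho%:R) = kappa n ^+ 2 :> R.
Proof. by rewrite -powR_mulrn ?powR_ge0// -powRrM mulrC. Qed.

Lemma powR_kappa n : (0 < n)%N -> n%:R `^ (1 - 2 / rho%:R) = n%:R / kappa n ^+ 2 :> R.
Proof.
move=> n0; rewrite powRB ?powRr1 ?kappa_sqr// ?ler0n//.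
by apply/implyP => _; rewrite pnatr_eq0 -lt0n.
Qed.

Lemma kappa_ge (A : R) : exists N, forall n, (N <= n)%N -> A <= kappa n.
Proof.
pose B := Num.max A 0.
exists (Num.truncn (B ^+ rho)).+1 => n Nn.
have B0 : 0 <= B by rewrite le_max lexx orbT.
have Bn : B ^+ rho <= n%:R.
  have /andP[_ h] := truncn_itv (exprn_ge0 rho B0).
  by rewrite (le_trans (ltW h))// ler_nat.
apply: (@le_trans _ _ B); first by rewrite le_max lexx.
rewrite -(@ler_pXn2r _ rho) ?nnegrE ?powR_ge0 ?kappaX_rho//.
exact: leq_trans rho_ge3.
Qed.

Lemma kappa_inv_le (e : R) : 0 < e -> exists N, forall n, (N <= n)%N ->
  (0 < n)%N /\ (kappa n)^-1 <= e.
Proof.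
move=> e0; have [N hN] := kappa_ge e^-1; exists N.+1 => n Nn.
have n0 : (0 < n)%N by exact: leq_ltn_trans Nn.
split=> //; rewrite -[leRHS]invrK lef_pV2 ?posrE ?invr_gt0 ?kappa_gt0//.
exact/hN/ltnW.
Qed.

Variable a : nat -> nat.
Hypothesis a_pos : forall n, (0 < n)%N -> (0 < a n)%N.
Variable q : R.
Hypothesis q_gt1 : 1 < q.
Hypothesis a_lac : forall n, (0 < n)%N -> q <= (a n.+1)%:R / (a n)%:R.

(** The given sequence starts at index 1, sums over ordinals at 0; [a 0] is arbitrary and is
    dropped. *)
Definition shifted k := a k.+1.

Lemma shifted_gt0 k : (0 < shifted k)%N. Proof. exact: a_pos. Qed.

Lemma shifted_lac k : q * (shifted k)%:R <= (shifted k.+1)%:R.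
Proof. by rewrite -ler_pdivlMr ?ltr0n ?a_pos// a_lac. Qed.

Lemma shifted_le k : (shifted k <= shifted k.+1)%N.
Proof.
rewrite -(ler_nat R); apply: le_trans (shifted_lac k).
by rewrite ler_peMl ?ler0n// ltW.
Qed.

Lemma shifted_mono j k : (j <= k)%N -> (shifted j <= shifted k)%N.
Proof.
move=> /subnK <-; elim: (k - j)%N => // i ih.
by rewrite addSn (leq_trans ih)// shifted_le.
Qed.

Lemma ratio_le1 k : (prev_freq shifted k)%:R / (shifted k)%:R <= 1 :> R.
Proof.
rewrite ler_pdivrMr ?ltr0n ?shifted_gt0// mul1r ler_nat.
by case: k => // k; exact: shifted_le.
Qed.

(** As rho - 1 >= 2, eventually [a k.+1] is at least [2 * D.+1 * k ^ 2 * a k]. The factor [D.+1]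
    gives the frequency gap, and [2 * k ^ 2 >= k * k.+1] a summable bound on the ratios. *)
Lemma growth_gap (D : nat) :
  ((a n.+1)%:R / (n%:R ^+ rho.-1 * (a n)%:R) : R) @[n --> \oo] --> +oo ->
  exists K0, [/\ (0 < K0)%N,
    forall k, (K0 <= k)%N -> forall j, (j < k)%N -> (k * (D * shifted j) < shifted k)%N &
    forall k, (K0 <= k)%N ->
      (prev_freq shifted k)%:R / (shifted k)%:R <= (k%:R * k.+1%:R)^-1 :> R].
Proof.
move=> /cvgryPge /(_ (2 * D.+1%:R)) [N _ hN].
have key k : (N.+1 <= k)%N -> (2 * D.+1 * (k * k) * a k <= a k.+1)%N.
  move=> Nk; have k0 : (0 < k)%N by exact: leq_trans Nk.
  have := hN k (ltnW Nk); rewrite /= ler_pdivlMr; last first.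
    by rewrite mulr_gt0 ?exprn_gt0 ?ltr0n ?a_pos.
  rewrite -natrX -!natrM ler_nat; apply: leq_trans.
  rewrite -[leqLHS]mulnA leq_mul2l leq_mul2r; apply/orP; right; apply/orP; right.
  by rewrite -[(k * k)%N]/(k ^ 2)%N leq_pexp2l// -ltnS prednK// (leq_trans _ rho_ge3).
exists N.+1; split=> // [k Nk j jk|k Nk]; have k0 : (0 < k)%N by exact: leq_trans Nk.
  have kE : k.-1.+1 = k by rewrite prednK.
  apply: leq_trans (key k Nk).
  have jk1 : (shifted j <= a k)%N by rewrite -kE -/(shifted k.-1) shifted_mono// -ltnS kE.
  have ak : (0 < a k)%N by exact: a_pos.
  apply: (@leq_ltn_trans (k * (D * a k))); first by rewrite !leq_mul2l jk1 !orbT.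
  rewrite mulnA ltn_pmul2r//.
  have : (k * D < k * D.+1)%N by rewrite ltn_pmul2l.
  move=> /leq_trans; apply; rewrite mulnC -mulnA [leqRHS]mulnCA leq_mul2l/=.
  by rewrite mulnA leq_pmull// muln_gt0.
have -> : prev_freq shifted k = a k by case: (k) k0.
rewrite ler_pdivrMr ?ltr0n ?shifted_gt0// ler_pdivlMl ?mulr_gt0 ?ltr0n//.
rewrite -!natrM ler_nat; apply: leq_trans (key k Nk).
rewrite leq_mul2r; apply/orP; right.
rewrite mulnS -mulnA mulnA.
have : (k <= k * k)%N by rewrite leq_pmull.
nia.
Qed.

(** The first [K0] ratios are at most 1 and the others telescope through 1/k - 1/(k+1), whence the
    strengthened bound with [1 - n%:R^-1] in the induction. *)
Lemma freq_ratio_sum_bounded K0 : (0 < K0)%N ->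
  (forall k, (K0 <= k)%N ->
     (prev_freq shifted k)%:R / (shifted k)%:R <= (k%:R * k.+1%:R)^-1 :> R) ->
  forall n, freq_ratio_sum R shifted n <= K0%:R + 1.
Proof.
move=> K00 hK.
suff H n : (0 < n)%N -> freq_ratio_sum R shifted n <= (minn n K0)%:R + (1 - n%:R^-1).
  case=> [|n]; first by rewrite /freq_ratio_sum big_ord0 addr_ge0.
  rewrite (le_trans (H _ _))// lerD ?ler_nat ?geq_minr// gerBl invr_ge0//.
case: n => // n _; elim: n => [|n ih].
  by rewrite /freq_ratio_sum big_ord_recr big_ord0 /= mul0r addr0 invr1 subrr addr0.
rewrite /freq_ratio_sum big_ord_recr /= -/(freq_ratio_sum R shifted n.+1).
have n1 : n.+2%:R^-1 <= n.+1%:R^-1 :> R by rewrite lef_pV2 ?posrE ?ltr0n// ler_nat.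
have [Kn|nK] := leqP K0 n.+1.
  move: ih; have -> : minn n.+1 K0 = K0 by apply/minn_idPr.
  have -> : minn n.+2 K0 = K0 by apply/minn_idPr; exact: leqW.
  have := hK n.+1 Kn; rewrite /=.
  have -> : (n.+1%:R * n.+2%:R)^-1 = n.+1%:R^-1 - n.+2%:R^-1 :> R.
    have gen (y : R) : 0 < y -> (y * (y + 1))^-1 = y^-1 - (y + 1)^-1.
      by move=> y0; field; rewrite !gt_eqF// ltr_wpDr.
    by rewrite -[n.+2%:R]natr1 gen.
  by move: (n.+1%:R^-1) (n.+2%:R^-1) => u v; lra.
move: ih; have -> : minn n.+1 K0 = n.+1 by apply/minn_idPl/ltnW.
have -> : minn n.+2 K0 = n.+2 by apply/minn_idPl.
have := ratio_le1 n.+1; move: n1.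
have -> : n.+2%:R + (1 - n.+2%:R^-1) = n.+1%:R + 1 + (1 - n.+2%:R^-1) :> R.
  by rewrite natr1.
rewrite /=.
move: (n.+1%:R^-1 : R) (n.+2%:R^-1 : R) (n.+1%:R : R) => u v w; lra.
Qed.

(** Each ratio of index below m is at most 1. The added term k = n on the right matches the range in
    the growth condition. *)
Lemma freq_ratio_sum_split m n :
  freq_ratio_sum R shifted n <= m%:R + \sum_(m <= k < n.+1) ((a k)%:R / (a k.+1)%:R : R).
Proof.
have crude i : freq_ratio_sum R shifted i <= i%:R.
  have -> : i%:R = \sum_(k < i) 1 :> R by rewrite sumr_const card_ord.
  by apply: ler_sum => k _; exact: ratio_le1.
suff H i : freq_ratio_sum R shifted i <= m%:R + \sum_(m <= k < i) ((a k)%:R / (a k.+1)%:R : R).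
  rewrite (le_trans (H n))// lerD2l; have [mn|nm] := leqP m n.
    by rewrite big_nat_recr//= lerDl divr_ge0.
  by rewrite !big_geq// ltnW.
have [im|mi] := leqP i m; first by rewrite big_geq// addr0 (le_trans (crude i))// ler_nat.
elim: i mi => // i ih; rewrite ltnS leq_eqVlt => /predU1P[<-|mi].
  rewrite big_nat1 /freq_ratio_sum big_ord_recr /= lerD//; first exact: crude.
  by case: (m) => [|?] /=; rewrite ?mul0r ?divr_ge0.
rewrite (big_nat_recr _ _ _ (ltnW mi))/= addrA /freq_ratio_sum big_ord_recr /= lerD//; first exact: ih.
by case: (i) => [|?] /=; rewrite ?mul0r ?divr_ge0.
Qed.

(** Splitting at the given ceiling leaves three pieces: [kappa n * x n], the 1 lost in rounding up,
    and the tail sum. Each is eventually at most a third of the bound. *)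
Lemma freq_ratio_sum_small (x : nat -> R) :
  (forall n, (0 < n)%N -> 0 < x n) -> x n @[n --> \oo] --> (0 : R) ->
  (fun n : nat => \sum_(`|Num.ceil (kappa n * x n)|%N <= k < n.+1)
     ((a k)%:R / (a k.+1)%:R : R)) =o_\oo kappa ->
  forall e : R, 0 < e -> exists N, forall n, (N <= n)%N ->
    freq_ratio_sum R shifted n <= e * kappa n ^+ 2.
Proof.
move=> x0 xcvg /eqoP so e e0.
have e3 : 0 < e / 3 by rewrite divr_gt0.
have [N1 _ h1] := (cvgr0Pnorm_le _).1 xcvg _ e3.
have [N2 _ h2] := so _ e3.
have [N3 h3] := kappa_ge 1.
have [N4 h4] := kappa_inv_le e3.
exists (maxn (maxn N1 N2) (maxn N3 N4)) => n.
rewrite !geq_max => /andP[/andP[n1 n2] /andP[n3 n4]].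
have {}h1 := h1 n n1; have {}h2 := h2 n n2; have {}h3 := h3 n n3.
have [n0 {}h4] := h4 n n4.
have k0 := kappa_gt0 n0; have xn := x0 n n0.
rewrite /= ger0_norm ?(ltW xn)// in h1.
rewrite /= (ger0_norm (ltW k0)) in h2.
set m := `|_|%N in h2.
apply: (le_trans (freq_ratio_sum_split m n)).
have mle : m%:R <= kappa n * x n + 1.
  have c0 : 0 <= Num.ceil (kappa n * x n).
    by rewrite ltW// ceil_gt0 mulr_gt0.
  have -> : m%:R = (Num.ceil (kappa n * x n))%:~R :> R.
    by rewrite -[in RHS](gez0_abs c0).
  by have := ceilB1_lt (kappa n * x n); rewrite intrB => /ltW; rewrite lerBlDr.
have tle := le_trans (ler_norm _) h2.
have kx : kappa n * x n <= kappa n * (e / 3) by rewrite ler_wpM2l// ltW.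
have k1 : 1 <= e / 3 * kappa n.
  by move: h4; rewrite -[X in X <= _]mul1r ler_pdivrMr.
have kk : kappa n <= kappa n ^+ 2 by rewrite expr2 ler_peMl// ltW.
have ek : e / 3 * kappa n <= e / 3 * kappa n ^+ 2 by rewrite ler_wpM2l// ltW.
move: mle tle kx k1 ek; lra.
Qed.

Lemma integral_ratio_dvd :
  (forall n, (0 < n)%N -> ((a n.+1)%:R / (a n)%:R : R) \is a Num.nat) ->
  forall k, (shifted k %| shifted k.+1)%N /\ (2 * shifted k <= shifted k.+1)%N.
Proof.
move=> nat_ratio k; have /natrP[m mE] := nat_ratio k.+1 isT.
have ak : 0 < (a k.+1)%:R :> R by rewrite ltr0n a_pos.
have aE : shifted k.+1 = (m * shifted k)%N.
  apply/eqP; rewrite -(eqr_nat R) natrM -mE divfK//; by rewrite gt_eqF.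
split; first by rewrite aE dvdn_mull.
rewrite aE leq_mul2r; apply/orP; right.
rewrite -(ltr_nat R) -mE; exact: lt_le_trans (a_lac _).
Qed.

End Normalization.

(** * The limits *)

Section LocallyUniform.
Variable R : realType.

(** Around z the unit ball is used as neighbourhood; it lies in the disc of radius [normc z + 1]. *)
Lemma locally_uniform_cvgP (F : nat -> R[i] -> R[i]) (G : R[i] -> R[i]) :
  (forall K e : R, 0 < e -> exists N, forall n, (N <= n)%N -> forall z,
     normc z <= K -> normc (F n z - G z) <= e) ->
  locally_uniform_cvg F G.
Proof.
move=> H z; exists (ball z 1); first exact: nbhsx_ballx.
move=> A /uniform_nbhs[E [entE EA]].
move: entE; rewrite -entourage_ballE => -[e /= e0 eE].
(* Radii are elements of [R[i]]; being positive there forces a zero imaginary part. *)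
have [eIm eRe] : Im e = 0 /\ 0 < Re e.
  by move: e0; rewrite ltcE /= => /andP[/eqP ? ?].
have [N hN] := H (normc z + 1) (Re e / 2) (divr_gt0 eRe (ltr0Sn _ 1)).
exists N => // n Nn; apply: EA => y zy; apply: eE => /=.
have zy1 : normc (z - y) < 1.
  by move: zy; rewrite /ball /= normr_normc -(rmorph1 (real_complex R)) ltcR.
have yK : normc y <= normc z + 1.
  rewrite -[y](subrK z) (le_trans (normcD _ _))// addrC lerD2l normcB.
  exact: ltW.
have eC : e = (Re e)%:C by apply: complex_eq => //=; rewrite eIm.
rewrite /ball /= eC normr_normc ltcR normcB (le_lt_trans (hN n Nn y yK))//.
by rewrite ltr_pdivrMr// ltr_pMr//; lra.
Qed.

End LocallyUniform.

Section Limit.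
Variables (R : realType) (D : nat) (f : R -> R) (M : R).
Hypothesis f_trig : trigp D (fun x => (f x)%:C).
Hypothesis M_gt0 : 0 < M.
Hypothesis f_bound : forall x, `|f x| <= M.
Hypothesis f_lip : forall x y, `|f x - f y| <= M * `|x - y|.
Hypothesis f_mean0 : mean f = 0.

Lemma expR_sub1_le (x : R) : 0 <= x -> x <= 1 / 2 -> expR x - 1 <= 2 * x.
Proof.
move=> x0 x2; have x1 : 0 < 1 - x by lra.
have := expR_le_inv (_ : x < 1); rewrite -subr_gt0 => /(_ x1) h.
have : (1 - x)^-1 <= 1 + 2 * x.
  rewrite -[leLHS]mul1r ler_pdivrMr//.
  have : 0 <= x * (1 - 2 * x) by rewrite mulr_ge0//; lra.
  lra.
lra.
Qed.

Variable rho : nat.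
Hypothesis rho_ge3 : (3 <= rho)%N.
Local Notation kappa := (@kappa R rho).

(** The constant [(K + 1) * (M + 1)] dominates both K and [K * M], so one N gives both bounds. *)
Lemma small_argument (K d : R) : 0 <= K -> 0 < d ->
  exists N, forall n, (N <= n)%N -> (0 < n)%N /\
    forall l : R[i], normc l <= K / kappa n -> normc l <= d /\ normc l * M <= d.
Proof.
move=> K0 d0; have c0 : 0 < (K + 1) * (M + 1) by rewrite mulr_gt0// ltr_wpDl// ltW.
have [N hN] := kappa_inv_le rho_ge3 (divr_gt0 d0 c0).
exists N => n /hN [n0 h]; split=> // l lK.
have k0 : 0 <= (kappa n)^-1 by rewrite invr_ge0 powR_ge0.
have h2 : (kappa n)^-1 * ((K + 1) * (M + 1)) <= d by rewrite -ler_pdivlMr.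
have KM : 0 <= K * M by rewrite mulr_ge0// ltW.
have kKM : 0 <= (kappa n)^-1 * (K * M) by rewrite mulr_ge0.
have kK : 0 <= (kappa n)^-1 * K by rewrite mulr_ge0.
have kM : 0 <= (kappa n)^-1 * M by rewrite mulr_ge0// ltW.
split; first by apply: le_trans lK _; rewrite mulrC; lra.
apply: (@le_trans _ _ (K / kappa n * M)); first by rewrite ler_wpM2r// ltW.
by rewrite mulrC mulrA (mulrC M) mulrC; lra.
Qed.

(** Together with the smallness of [freq_ratio_sum], this is all that the final limits use of the
    growth condition. *)
Definition factorizes (b : nat -> nat) := forall K e : R, 0 <= K -> 0 < e ->
  exists N, forall n, (N <= n)%N -> forall l : R[i], normc l <= K / kappa n ->
    normc (cmean (dilated_prod (tilted f l) b n) - 1) <= e.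

Lemma factorizes_gap (b : nat -> nat) (K0 : nat) : (forall k, (0 < b k)%N) ->
  (forall k, (K0 <= k)%N -> forall j, (j < k)%N -> (k * (D * b j) < b k)%N) ->
  factorizes b.
Proof.
move=> b0 gap K e Kge0 e0.
have c0 : 0 < 32 * 4 ^+ K0 :> R by rewrite mulr_gt0 ?exprn_gt0.
have d0 : 0 < Num.min (1 / 160) (e / (32 * 4 ^+ K0)).
  by rewrite lt_min !divr_gt0.
have [N hN] := small_argument Kge0 d0; exists N => n /hN [_ h] l /h [_].
rewrite le_min => /andP[l1 l2].
rewrite (le_trans (dilated_prod_gap f_trig M_gt0 f_bound l1 b0 gap n))//.
move: l2; rewrite ler_pdivlMr//; apply: le_trans.
by rewrite le_eqVlt; apply/orP; left; apply/eqP; ring.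
Qed.

(** The exponent in [dilated_prod_divisible] is of order [kappa n ^- 2] times the ratio sum. *)
Lemma factorizes_divisible (b : nat -> nat) : (forall k, (0 < b k)%N) ->
  (forall k, (b k %| b k.+1)%N) -> (forall k, (2 * b k <= b k.+1)%N) ->
  (forall e : R, 0 < e -> exists N, forall n, (N <= n)%N ->
    freq_ratio_sum R b n <= e * kappa n ^+ 2) ->
  factorizes b.
Proof.
move=> b0 bdvd b2 bsum K e Kge0 e0.
have d0 : 0 < 1 / 160 :> R by rewrite divr_gt0.
have [N1 hN1] := small_argument Kge0 d0.
(* The summand 1 keeps c positive when K = 0, so that it can be divided by. *)
pose c := 6 * (16 * (K * M)) ^+ 2 + 1.
have cge : 0 <= 6 * (16 * (K * M)) ^+ 2 by rewrite mulr_ge0 ?sqr_ge0.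
have c0 : 0 < c by rewrite ltr_wpDl.
have e'0 : 0 < Num.min (1 / 2) (e / 2) / c by rewrite divr_gt0// lt_min !divr_gt0.
have [N2 hN2] := bsum _ e'0.
exists (maxn N1 N2) => n; rewrite geq_max => /andP[n1 n2] l lK.
have [n0 /(_ _ lK) [_ l1]] := hN1 n n1; have sn := hN2 n n2.
have k0 : 0 < kappa n := kappa_gt0 R rho n0.
pose eta := 16 * (normc l * M).
have lM0 : 0 <= normc l * M by rewrite mulr_ge0 ?normc_ge0// ltW.
have eta10 : eta <= 1 / 10 by rewrite /eta; lra.
have eta0 : 0 <= eta by rewrite mulr_ge0.
have := @dilated_prod_divisible R (tilted f l) eta b (tilted_continuous f_trig l)
  (tilted_periodic f_trig l) (cmean_tilted f_trig f_bound l1)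
  (tilted_sub1 f_trig f_bound l1)
  (tilted_lipschitz f_trig f_bound f_lip l1) eta10 b0 bdvd b2 n.
move=> /le_trans; apply.
rewrite -mulr_sumr -/(freq_ratio_sum R b n).
have etaK : eta <= 16 * (K * M) / kappa n.
  rewrite /eta -mulrA ler_wpM2l// mulrAC ler_wpM2r// ltW//.
have s0 : 0 <= freq_ratio_sum R b n by apply: sumr_ge0 => k _; rewrite divr_ge0.
set m := Num.min (1 / 2) (e / 2) in e'0 sn.
have m0 : 0 < m by rewrite lt_min !divr_gt0.
have xm : 6 * eta ^+ 2 * freq_ratio_sum R b n <= m.
  have e2 : eta ^+ 2 <= (16 * (K * M)) ^+ 2 / kappa n ^+ 2.
    by rewrite -expr_div_n lerXn2r ?nnegrE// divr_ge0 ?powR_ge0// !mulr_ge0// ltW.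
  apply: (@le_trans _ _ (6 * ((16 * (K * M)) ^+ 2 / kappa n ^+ 2) * (m / c * kappa n ^+ 2))).
    apply: ler_pM => //; first by rewrite mulr_ge0 ?sqr_ge0.
    by rewrite ler_wpM2l.
  have -> : 6 * ((16 * (K * M)) ^+ 2 / kappa n ^+ 2) * (m / c * kappa n ^+ 2) =
     (6 * (16 * (K * M)) ^+ 2) / c * m by field; rewrite !gt_eqF.
  by rewrite ler_piMl ?(ltW m0)// ler_pdivrMr// mul1r /c lerDl.
have x0 : 0 <= 6 * eta ^+ 2 * freq_ratio_sum R b n by rewrite mulr_ge0// mulr_ge0 ?sqr_ge0.
have m2 : m <= 1 / 2 by rewrite /m ge_min lexx.
have me : m <= e / 2 by rewrite /m ge_min lexx orbT.
apply: le_trans (expR_sub1_le x0 (le_trans xm m2)) _.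
by move: xm me; lra.
Qed.

Variable gam : R.
Hypothesis cumulants_vanish :
  forall m, (3 <= m < rho)%N -> derive1n m (log_mgf f) 0 = 0.
Hypothesis cumulant_gam : derive1n rho (log_mgf f) 0 = gam.

Local Notation lpoly := (log_mgf_poly f rho gam).

(** Since [kappa n ^+ rho = n%:R], the accumulated error [n%:R * normc l ^+ rho.+1] is at most
    [K ^+ rho.+1 / kappa n]. *)
Lemma cmgf_power_ratio (K e : R) : 0 <= K -> 0 < e ->
  exists N, forall n, (N <= n)%N -> forall l : R[i], normc l <= K / kappa n ->
    normc ((cexp (- ceval lpoly l) * cmgf f l) ^+ n - 1) <= e.
Proof.
move=> K0 e0.
have [C C0 hC] := cmgf_ratio f_trig M_gt0 f_bound f_mean0 rho_ge3
  cumulants_vanish cumulant_gam.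
have [N1 hN1] := small_argument K0 ltr01.
pose c := C * K ^+ rho.+1 + 1.
have cge : 0 <= C * K ^+ rho.+1 by rewrite mulr_ge0 ?exprn_ge0.
have c0 : 0 < c by rewrite ltr_wpDl.
have e'0 : 0 < Num.min (1 / 2) (e / 2) / c by rewrite divr_gt0// lt_min !divr_gt0.
have [N2 hN2] := kappa_inv_le rho_ge3 e'0.
exists (maxn N1 N2) => n; rewrite geq_max => /andP[n1 n2] l lK.
have [n0 /(_ _ lK) [l1 _]] := hN1 n n1; have [_ kn] := hN2 n n2.
have k0 : 0 < kappa n := kappa_gt0 R rho n0.
set w := cexp (- ceval lpoly l) * cmgf f l.
pose d := C * normc l ^+ rho.+1.
have d0 : 0 <= d by rewrite mulr_ge0 ?exprn_ge0 ?normc_ge0.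
have step k : (k < n)%N -> normc (w ^+ k.+1 - w ^+ k) <= d * normc (w ^+ k).
  move=> _; have -> : w ^+ k.+1 - w ^+ k = (w - 1) * w ^+ k by rewrite exprS mulrBl mul1r.
  by rewrite ComplexField.Normc.normcM ler_wpM2r ?normc_ge0// hC.
have := @normc_relative_increments R (fun k => w ^+ k) (fun=> d) n (expr0 _) (fun=> d0) step.
move=> /le_trans; apply.
rewrite sumr_const card_ord -mulr_natl.
set m := Num.min (1 / 2) (e / 2) in e'0 kn.
have m0 : 0 < m by rewrite lt_min !divr_gt0.
have ndm : n%:R * d <= m.
  apply: (@le_trans _ _ (n%:R * (C * (K / kappa n) ^+ rho.+1))).
    rewrite ler_wpM2l// ler_wpM2l// lerXn2r ?nnegrE ?normc_ge0// divr_ge0// ltW//.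
  rewrite expr_div_n [kappa n ^+ _]exprS kappaX_rho//.
  have -> : n%:R * (C * (K ^+ rho.+1 / (kappa n * n%:R))) =
      (C * K ^+ rho.+1) * (kappa n)^-1.
    by field; rewrite pnatr_eq0 -lt0n n0 gt_eqF.
  apply: (@le_trans _ _ (C * K ^+ rho.+1 * (m / c))); first by rewrite ler_wpM2l.
  rewrite mulrA mulrAC ler_piMl ?(ltW m0)// ler_pdivrMr// mul1r /c lerDl//.
have nd0 : 0 <= n%:R * d by rewrite mulr_ge0.
have m2 : m <= 1 / 2 by rewrite /m ge_min lexx.
have me : m <= e / 2 by rewrite /m ge_min lexx orbT.
apply: le_trans (expR_sub1_le nd0 (le_trans ndm m2)) _.
by move: ndm me; lra.
Qed.

Variable b : nat -> nat.
Hypothesis b_gt0 : forall k, (0 < b k)%N.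
Hypothesis b_factorizes : factorizes b.
Hypothesis b_ratio_sum : forall e : R, 0 < e -> exists N, forall n, (N <= n)%N ->
  freq_ratio_sum R b n <= e * kappa n ^+ 2.
Variable q : R.
Hypothesis q_gt1 : 1 < q.
Hypothesis b_lac : forall k, q * (b k)%:R <= (b k.+1)%:R.

Let s2 := mean (fun x => f x ^+ 2).
Let v n := mean (fun x => dilated_sum f b n x ^+ 2).
Let mgf n (z : R[i]) := cmean (fun x => cexp (z * (dilated_sum f b n x / kappa n)%:C)).
Let lim_fun (z : R[i]) := cexp (z ^+ rho * (gam / rho`!%:R)%:C).

(** This factor is the quotient of the two Gaussian normalizations and turns the first limit into
    the second. *)
Lemma variance_correction (K e : R) : 0 <= K -> 0 < e ->
  exists N, forall n, (N <= n)%N -> forall z : R[i], normc z <= K ->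
    normc (cexp (- (z ^+ 2 * ((v n - n%:R * s2) / (2 * kappa n ^+ 2))%:C)) - 1) <= e.
Proof.
move=> K0 e0.
pose A := 2 * M ^+ 2 * (q / (q - 1)).
have A0 : 0 <= A.
  apply: mulr_ge0; first by rewrite mulr_ge0 ?sqr_ge0.
  by apply: divr_ge0; [exact: ltW (lt_trans ltr01 q_gt1)|rewrite subr_ge0 ltW].
pose c := K ^+ 2 * A + 1.
have cge : 0 <= K ^+ 2 * A by rewrite mulr_ge0 ?sqr_ge0.
have c0 : 0 < c by rewrite ltr_wpDl.
pose m := Num.min (1 / 2) (e / 4).
have m0 : 0 < m by rewrite lt_min !divr_gt0.
have [N1 hN1] := b_ratio_sum (divr_gt0 m0 c0).
exists N1.+1 => n n1 z zK.
have k0 : 0 < kappa n by apply: kappa_gt0; exact: leq_ltn_trans n1.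
have sn := hN1 n (ltnW n1).
have va := variance_close f_trig f_bound f_lip f_mean0 b_gt0 q_gt1 b_lac n.
set y := - _.
have ym : normc y <= m.
  rewrite /y normcN ComplexField.Normc.normcM normcX normc_real normrM normfV.
  have kk : 0 < 2 * kappa n ^+ 2 by rewrite mulr_gt0 ?exprn_gt0.
  rewrite (gtr0_norm kk) mulrA ler_pdivrMr//.
  apply: (@le_trans _ _ (K ^+ 2 * (A * (m / c * kappa n ^+ 2)))).
    rewrite ler_pM ?exprn_ge0 ?normc_ge0//.
      by rewrite lerXn2r ?nnegrE ?normc_ge0.
    by rewrite (le_trans va)// ler_wpM2l.
  have -> : K ^+ 2 * (A * (m / c * kappa n ^+ 2)) =
      (K ^+ 2 * A / c) * (m * kappa n ^+ 2) by ring.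
  have -> : m * (2 * kappa n ^+ 2) = 2 * (m * kappa n ^+ 2) by ring.
  have mk : 0 <= m * kappa n ^+ 2 by rewrite mulr_ge0 ?sqr_ge0// ltW.
  rewrite ler_wpM2r//.
  by rewrite ler_pdivrMr// /c; move: cge; lra.
have m2 : m <= 1 / 2 by rewrite /m ge_min lexx.
have me : m <= e / 4 by rewrite /m ge_min lexx orbT.
rewrite (le_trans (cexp_sub1 y))//.
apply: (@le_trans _ _ (2 * m * 2)); last by move: me; lra.
rewrite ler_pM ?mulr_ge0 ?normc_ge0 ?expR_ge0 ?ler_wpM2l// expR_le2//.
exact: le_trans m2.
Qed.

Lemma normc_lim_fun (K : R) z : normc z <= K ->
  normc (lim_fun z) <= expR (K ^+ rho * `|gam / rho`!%:R|).
Proof.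
move=> zK; rewrite (le_trans (normc_cexp_le _))// ler_expR.
rewrite ComplexField.Normc.normcM normcX normc_real ler_wpM2r//.
by rewrite lerXn2r ?nnegrE ?normc_ge0// (le_trans _ zK)// normc_ge0.
Qed.

(** An exact identity. With [l = z / kappa n], n times the quadratic term of [lpoly] at l is the
    Gaussian exponent, and n times its term of degree rho is the exponent of [lim_fun z], because
    [kappa n ^+ rho = n%:R]. *)
Lemma mgf_factor n z : (0 < n)%N ->
  cmgf f (z * (kappa n)^-1%:C) != 0 ->
  cexp (- (z ^+ 2 * (n%:R / kappa n ^+ 2 * s2 / 2)%:C)) * mgf n z =
  lim_fun z * ((cexp (- ceval lpoly (z * (kappa n)^-1%:C)) *
    cmgf f (z * (kappa n)^-1%:C)) ^+ n *
    cmean (dilated_prod (tilted f (z * (kappa n)^-1%:C)) b n)).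
Proof.
move=> n0; set l := z * _ => cl0.
have k0 : 0 < kappa n := kappa_gt0 R rho n0.
have -> : mgf n z = cmgf f l ^+ n * cmean (dilated_prod (tilted f l) b n).
  rewrite -cmeanZ; last first.
    by apply: dilated_prod_continuous; exact: (tilted_continuous f_trig).
  congr cmean; apply/funext => x; rewrite prod_tilted.
  rewrite [RHS]mulrC divfK ?expf_neq0//; congr cexp.
  by rewrite /l /dilated_sum rmorphM /=; ring.
have -> : cexp (- (z ^+ 2 * (n%:R / kappa n ^+ 2 * s2 / 2)%:C)) =
    lim_fun z * cexp (- ceval lpoly l) ^+ n.
  rewrite -cexpMn /lim_fun -cexpD; congr cexp.
  rewrite ceval_log_mgf_poly /l !exprMn -!(rmorphXn (real_complex R)) /=.
  rewrite !exprVn kappaX_rho// -/s2 mulrN mulrDr opprD addrCA.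
  have nC : n%:R = (n%:R : R)%:C by rewrite rmorph_nat.
  have -> : n%:R * (z ^+ rho * n%:R^-1%:C * (gam / rho`!%:R)%:C) =
      z ^+ rho * (gam / rho`!%:R)%:C.
    rewrite fmorphV rmorph_nat; field.
    by rewrite !pnatr_eq0 -!lt0n fact_gt0.
  rewrite subrr addr0; congr (- _); rewrite nC !rmorphM /=; ring.
by rewrite exprMn; ring.
Qed.

(** Expanding the product around 1 gives 7 nonempty products of the differences, each at most e
    because e <= 1. *)
Lemma three_factors (L u1 u2 u3 : R[i]) (B e : R) : normc L <= B -> 0 <= e -> e <= 1 ->
  normc (u1 - 1) <= e -> normc (u2 - 1) <= e -> normc (u3 - 1) <= e ->
  normc (L * (u1 * u2) * u3 - L) <= B * (7 * e).
Proof.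
move=> LB e0 e1 h1 h2 h3.
have -> : L * (u1 * u2) * u3 - L = L * ((u1 - 1) * (u2 - 1) * (u3 - 1)
   + ((u1 - 1) * (u2 - 1) + (u1 - 1) * (u3 - 1) + (u2 - 1) * (u3 - 1))
   + (u1 - 1 + (u2 - 1) + (u3 - 1))) by ring.
rewrite ComplexField.Normc.normcM ler_pM ?normc_ge0//.
set x := u1 - 1 in h1 *; set y := u2 - 1 in h2 *; set w := u3 - 1 in h3 *.
have p2 s t : normc s <= e -> normc t <= e -> normc (s * t) <= e.
  move=> hs ht; rewrite ComplexField.Normc.normcM -[leRHS]mulr1 ler_pM ?normc_ge0//.
  exact: le_trans e1.
have xy := p2 _ _ h1 h2; have xw := p2 _ _ h1 h3; have yw := p2 _ _ h2 h3.
have xyw := p2 _ _ xy h3.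
have t1 := normcD (x * y * w + (x * y + x * w + y * w)) (x + y + w).
have t2 := normcD (x * y * w) (x * y + x * w + y * w).
have t3 := normcD (x * y + x * w) (y * w).
have t4 := normcD (x * y) (x * w).
have t5 := normcD (x + y) w.
have t6 := normcD x y.
lra.
Qed.

Lemma uniform_limits (K e : R) : 0 <= K -> 0 < e ->
  exists N, forall n, (N <= n)%N -> forall z : R[i], normc z <= K ->
    normc (cexp (- (z ^+ 2 * (n%:R `^ (1 - 2 / rho%:R) * s2 / 2)%:C)) * mgf n z
      - lim_fun z) <= e /\
    normc (cexp (- (z ^+ 2 * (v n / (2 * n%:R `^ (2 / rho%:R)))%:C)) * mgf n z
      - lim_fun z) <= e.
Proof.
move=> K0 e0.
pose B := expR (K ^+ rho * `|gam / rho`!%:R|).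
have B0 : 0 < B by exact: expR_gt0.
(* Chosen for [three_factors]: d <= 1 and [B * (7 * d) <= e]. *)
pose d := Num.min 1 (e / (7 * B)).
have d0 : 0 < d by rewrite lt_min ltr01 divr_gt0// mulr_gt0.
have d1 : d <= 1 by rewrite /d ge_min lexx.
have dB : B * (7 * d) <= e.
  have : d <= e / (7 * B) by rewrite /d ge_min lexx orbT.
  by rewrite ler_pdivlMr ?mulr_gt0//; apply: le_trans; rewrite le_eqVlt; apply/orP; left; apply/eqP; ring.
have [N1 h1] := cmgf_power_ratio K0 d0.
have [N2 h2] := b_factorizes K0 d0.
have [N3 h3] := variance_correction K0 d0.
have d160 : 0 < 1 / 160 :> R by rewrite divr_gt0.
have [N4 h4] := small_argument K0 d160.
exists (maxn (maxn N1 N2) (maxn N3 N4)) => n.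
rewrite !geq_max => /andP[/andP[n1 n2] /andP[n3 n4]] z zK.
have [n0 {}h4] := h4 n n4.
have k0 : 0 < kappa n := kappa_gt0 R rho n0.
pose l := z * (kappa n)^-1%:C.
have lK : normc l <= K / kappa n.
  rewrite ComplexField.Normc.normcM normc_real ger0_norm ?invr_ge0 ?(ltW k0)//.
  by rewrite ler_wpM2r// invr_ge0 ltW.
have [_ l1] := h4 l lK.
have cl0 := cmgf_neq0 f_trig f_bound l1.
have {}h1 := h1 n n1 l lK; have {}h2 := h2 n n2 l lK; have {}h3 := h3 n n3 z zK.
have LB := normc_lim_fun zK.
have E := mgf_factor n0 cl0.
split.
  rewrite powR_kappa// E.
  have := three_factors LB (ltW d0) d1 h1 h2 (u3 := 1).
  rewrite subrr ComplexField.Normc.normc0 mulr1 => /(_ (ltW d0)) h.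
  exact: le_trans h dB.
rewrite kappa_sqr//.
have -> : cexp (- (z ^+ 2 * (v n / (2 * kappa n ^+ 2))%:C)) =
    cexp (- (z ^+ 2 * ((v n - n%:R * s2) / (2 * kappa n ^+ 2))%:C)) *
    cexp (- (z ^+ 2 * (n%:R / kappa n ^+ 2 * s2 / 2)%:C)).
  rewrite -cexpD; congr cexp; rewrite -opprD -mulrDr -rmorphD /=.
  by congr (- (_ * _%:C)); field; rewrite gt_eqF.
rewrite -mulrA E mulrC.
exact: le_trans (three_factors LB (ltW d0) d1 h1 h2 h3) dB.
Qed.

End Limit.

(** * From the probabilistic statement to means over a period *)

Section FromTrigPoly.
Variables (R : realType) (D : nat) (c : int -> R) (f : R -> R).
Hypothesis f_trig : forall x : R, (f x)%:C = trig_poly D c x.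

Let freq_le (k : 'I_(2 * D).+1) : (`|k%:Z - D%:Z| <= D)%N.
Proof. have := ltn_ord k; lia. Qed.

Lemma trig_poly_trigp : trigp D (fun x => (f x)%:C).
Proof.
under eq_fun do rewrite f_trig.
apply: trigp_sum => k _; exact: (@trigp_char _ _ (c (k%:Z - D%:Z))%:C).
Qed.

Lemma mean_trig_poly : c 0 = 0 -> mean f = 0.
Proof.
move=> c0; apply: (@complexI R); rewrite -cmean_real.
under eq_fun do rewrite f_trig.
rewrite /trig_poly cmean_sum; last first.
  by move=> k; apply: ccontinuousM; [exact: ccontinuous_cst|exact: char_continuous].
rewrite big1// => k _; set d := k%:Z - D%:Z.
rewrite cmeanZ; last exact: char_continuous.
by have [->|d0] := eqVneq d 0; rewrite ?c0 ?mul0r// cmean_char// mulr0.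
Qed.

End FromTrigPoly.

Section ProbabilityLink.
Context (R : realType) (disp : measure_display) (T : measurableType disp).
Variables (P : probability T R) (U : {RV P >-> R}).
Hypothesis U_uniform : uniform01 U.
Variables (D : nat) (f : R -> R) (a : nat -> nat).
Hypothesis f_trig : trigp D (fun x => (f x)%:C).
Hypothesis a_pos : forall n, (0 < n)%N -> (0 < a n)%N.

(** Dilation by [a 1] preserves means of functions of period 1, so the first summand has the moment
    generating function of f itself. *)
Lemma cumulant_log_mgf m : cumulant P (dilate f a U 1) m = derive1n m (log_mgf f) 0.
Proof.
rewrite /cumulant; congr (derive1n m _ 0); apply/funext => t; congr (ln _).
rewrite /mmt_gen_fun.
pose h x := f x ^+ 0 * expR (t * f x).
have ch : continuous h := @exp_moment_integrand_continuous R D f f_trig 0 t.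
have -> : (expR \o t \o* dilate f a U 1) = (fun w => h ((a 1)%:R * U w)).
  by apply/funext => w; rewrite /h /dilate expr0 mul1r /= mulrC.
have chd : continuous (fun x : R => h ((a 1)%:R * x)).
  have := ccontinuous_dilate (a 1)%:R (ccontinuous_real ch).
  by case.
rewrite (expectation_uniform01 U_uniform chd) /= mean_dilate//; last exact: a_pos.
by move=> x; rewrite /h (f_periodic f_trig).
Qed.

Lemma dilate_sumE n w : dilate_sum f a U n w = dilated_sum f (shifted a) n (U w).
Proof. by rewrite /dilate_sum big_add1 big_mkord. Qed.

Lemma second_moment_dilate :
  fine ('E_P[(fun w => dilate f a U 1 w ^+ 2)%R])%E = mean (fun x => f x ^+ 2).
Proof.
have c2 : continuous (fun x : R => f x ^+ 2) := @f_pow_continuous R D f f_trig 2.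
have chd : continuous (fun x : R => f ((a 1)%:R * x) ^+ 2).
  by have := ccontinuous_dilate (a 1)%:R (ccontinuous_real c2); case.
rewrite (expectation_uniform01 U_uniform chd) /=.
rewrite (@mean_dilate _ (fun x => f x ^+ 2))//; last exact: a_pos.
by move=> x; rewrite (f_periodic f_trig).
Qed.

Lemma second_moment_dilate_sum n :
  fine ('E_P[(fun w => dilate_sum f a U n w ^+ 2)%R])%E =
  mean (fun x => dilated_sum f (shifted a) n x ^+ 2).
Proof.
have cS : continuous (fun x : R => dilated_sum f (shifted a) n x ^+ 2).
  have := ccontinuousX 2 (ccontinuous_real (@dilated_sum_continuous R D f f_trig (shifted a) n)).
  by under eq_fun do rewrite -(rmorphXn (real_complex R)); case.
under [X in 'E_P[X]%E]eq_fun do rewrite dilate_sumE.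
by rewrite (expectation_uniform01 U_uniform cS).
Qed.

Lemma cexpectation_dilate_sum (s : R) n (z : R[i]) :
  cexpectation P (fun w => cexp (z * (dilate_sum f a U n w / s)%:C)) =
  cmean (fun x => cexp (z * (dilated_sum f (shifted a) n x / s)%:C)).
Proof.
under [X in cexpectation P X]eq_fun do rewrite dilate_sumE.
apply: (cexpectation_uniform01 U_uniform
  (F := fun x => cexp (z * (dilated_sum f (shifted a) n x / s)%:C))).
apply: ccontinuous_cexp; apply: ccontinuousM; first exact: ccontinuous_cst.
apply: ccontinuous_real => x; apply: cvgM; last exact: cvg_cst.
exact: (dilated_sum_continuous f_trig).
Qed.

End ProbabilityLink.

Theorem theorem13 (R : realType) (disp : measure_display)
  (T : measurableType disp) (P : probability T R)
  (a : nat -> nat)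
  (a_pos : forall n, (0 < n)%N -> (0 < a n)%N)
  (a_lacunary : exists2 q : R, 1 < q &
     forall n, (0 < n)%N -> q <= (a n.+1)%:R / (a n)%:R)
  (D : nat) (c : int -> R) (f : R -> R)
  (f_trig : forall x : R, (f x)%:C = trig_poly D c x)
  (c_sym : forall d : int, `|d| <= D%:Z -> c d = c (- d))
  (c_0 : c 0 = 0)
  (c_neq0 : 0 < \sum_(k < (2 * D).+1) c (k%:Z - D%:Z) ^+ 2)
  (U : {RV P >-> R}) (U_uniform : uniform01 U)
  (rho : nat) (rho_ge3 : (3 <= rho)%N)
  (cumulant_lt_rho : forall m, (3 <= m < rho)%N ->
     cumulant P (dilate f a U 1) m = 0)
  (cumulant_rho : cumulant P (dilate f a U 1) rho != 0)
  (growth :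
     ((a n.+1)%:R / (n%:R ^+ rho.-1 * (a n)%:R) : R) @[n --> \oo] --> +oo
     \/
     ((forall n, (0 < n)%N ->
         ((a n.+1)%:R / (a n)%:R : R) \is a Num.nat) /\
      exists x : nat -> R,
        [/\ forall n, (0 < n)%N -> 0 < x n,
            x n @[n --> \oo] --> (0 : R) &
            (fun n : nat =>
               \sum_(`|Num.ceil (n%:R `^ (rho%:R^-1) * x n)|%N <= k < n.+1)
                 ((a k)%:R / (a k.+1)%:R : R))
            =o_\oo (fun n : nat => n%:R `^ (rho%:R^-1) : R)])) :
  let S := dilate_sum f a U in
  let EX1sq : R := fine ('E_P[(fun w => dilate f a U 1 w ^+ 2)%R])%E in
  let sigmasq (n : nat) : R := fine ('E_P[(fun w => S n w ^+ 2)%R])%E in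
  let mgf (n : nat) (theta : R[i]) : R[i] :=
    cexpectation P
      (fun w => cexp (theta * (S n w / n%:R `^ (rho%:R^-1))%:C)) in
  let limit (theta : R[i]) : R[i] :=
    cexp (theta ^+ rho * (cumulant P (dilate f a U 1) rho / rho`!%:R)%:C) in
  locally_uniform_cvg
    (fun (n : nat) (theta : R[i]) =>
       cexp (- (theta ^+ 2 * (n%:R `^ (1 - 2 / rho%:R) * EX1sq / 2)%:C))
       * mgf n theta)
    limit
  /\
  locally_uniform_cvg
    (fun (n : nat) (theta : R[i]) =>
       cexp (- (theta ^+ 2 * (sigmasq n / (2 * n%:R `^ (2 / rho%:R)))%:C))
       * mgf n theta)
    limit.
Proof.
have [q q1 a_lac] := a_lacunary.
have tf := trig_poly_trigp f_trig.
have f_mean0 := mean_trig_poly f_trig c_0.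
have [B B0 fB] := trigp_bounded tf.
have [L L0 fL] := trigp_lipschitz tf.
(* One constant serves as sup bound and Lipschitz constant; the 1 makes it positive. *)
pose M := B + L + 1.
have M0 : 0 < M by rewrite ltr_wpDl// addr_ge0.
have f_bound x : `|f x| <= M.
  by rewrite -normc_real (le_trans (fB x))// /M -addrA lerDl addr_ge0.
have f_lip x y : `|f x - f y| <= M * `|x - y|.
  rewrite -normc_real rmorphB (le_trans (fL x y))// ler_wpM2r//.
  by rewrite /M -addrA addrCA lerDl addr_ge0.
have b_gt0 := shifted_gt0 a_pos.
have b_lac := shifted_lac a_pos a_lac.
pose gam := cumulant P (dilate f a U 1) rho.
have link m := cumulant_log_mgf U_uniform tf a_pos m.
have vanish m : (3 <= m < rho)%N -> derive1n m (log_mgf f) 0 = 0.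
  by move=> /cumulant_lt_rho; rewrite link.
have gamE : derive1n rho (log_mgf f) 0 = gam by rewrite /gam link.
(* Both growth conditions are brought to the same two facts, after which the cases no longer
   differ. *)
have [ratio_small fact] : (forall e : R, 0 < e -> exists N, forall n, (N <= n)%N ->
    freq_ratio_sum R (shifted a) n <= e * kappa R rho n ^+ 2) /\
    factorizes f rho (shifted a).
  case: growth => [gap|[nat_ratio [x [x0 xcvg so]]]].
    have [K0 [K00 gapK ratioK]] := growth_gap rho_ge3 a_pos q1 a_lac D gap.
    split; last exact: (factorizes_gap tf M0 f_bound rho_ge3 b_gt0 gapK).
    (* The ratio sum is bounded here, and eventually [K0%:R + 1 <= e * kappa n <= e * kappa n ^+
       2]. *)
    move=> e e0; have bnd := freq_ratio_sum_bounded a_pos q1 a_lac K00 ratioK.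
    have c0 : 0 < K0%:R + 1 :> R by rewrite ltr_wpDl.
    have [N1 h1] := @kappa_ge R rho rho_ge3 1.
    have [N2 h2] := @kappa_ge R rho rho_ge3 ((K0%:R + 1) / e).
    exists (maxn N1 N2) => n; rewrite geq_max => /andP[/h1 k1 /h2].
    rewrite ler_pdivrMr// mulrC => k2.
    rewrite (le_trans (bnd n))// (le_trans k2)// ler_wpM2l ?(ltW e0)//.
    by rewrite expr2 ler_peMl// (le_trans _ k1).
  have small := freq_ratio_sum_small rho_ge3 a_pos q1 a_lac x0 xcvg so.
  have dvd := integral_ratio_dvd a_pos q1 a_lac nat_ratio.
  split=> //; exact: (factorizes_divisible tf M0 f_bound f_lip rho_ge3 b_gt0
    (fun k => (dvd k).1) (fun k => (dvd k).2) small).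
move=> S EX1sq sigmasq mgf limit.
split; apply: locally_uniform_cvgP => K e e0.
  have [N hN] := uniform_limits tf M0 f_bound f_lip f_mean0 rho_ge3 vanish gamE
    b_gt0 fact ratio_small q1 b_lac (normr_ge0 K) e0.
  exists N => n Nn z zK; have [h _] := hN n Nn z (le_trans zK (ler_norm K)).
  rewrite /mgf /EX1sq (second_moment_dilate U_uniform tf a_pos).
  by rewrite (cexpectation_dilate_sum U_uniform a tf).
have [N hN] := uniform_limits tf M0 f_bound f_lip f_mean0 rho_ge3 vanish gamE
  b_gt0 fact ratio_small q1 b_lac (normr_ge0 K) e0.
exists N => n Nn z zK; have [_ h] := hN n Nn z (le_trans zK (ler_norm K)).
rewrite /mgf /sigmasq (second_moment_dilate_sum U_uniform a tf).
by rewrite (cexpectation_dilate_sum U_uniform a tf).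
Qed.
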